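(* There is an absolute constant $C$ such that the following holds. Let $T=(V,E)$ be a semi-labeled tree with $n$ regular nodes $W$, maximum degree $\Delta\ge 2$, and strictly positive edge lengths, and let $D=[d(u,v)]_{u,v\in W}$ be the oracle giving the tree distances between regular nodes. Then the randomized algorithm TREE described in the context, run with parameter $\kappa=\Delta$ and access to the oracle $D$, correctly recovers the tree, i.e. it returns the edge set of $T$ (up to the naming of the latent nodes), and its expected query complexity (expected number of queries to the oracle $D$) is at most $C\,\Delta\, n\log_\Delta(n)$.
   Context: Trees. A semi-labeled tree is a finite tree $T=(V,E)$ with a set $W\subseteq V$ of regular (labeled) nodes such that every vertex of degree $\le 2$ lies in $W$; vertices in $V\setminus W$ are called latent. Given $\ell:E\to(0,\infty)$, $d(u,v)$ is the sum of $\ell(e)$ over the edges $e$ of the path from $u$ to $v$ (and $d(u,u)=0$). $\Delta=\max_{v\in V}\deg(v)$. Only $d(u,v)$ for $u,v\in W$ (and $\Delta$) is available, through an oracle; a query is one evaluation of $d$ at a pair of regular nodes. Bags. A bag is a set $B\subseteq V$ with a distinguished representative $\rho(B)\in B$; all elements of $B$ other than possibly $\rho(B)$ are regular. When $\rho(B)$ is latent, the distances $d(v,\rho(B))$, $v\in B$, have been computed, so it acts as a regular node. The tree induced by $B$ is the smallest subtree of $T$ containing $B$. A skeleton is a set of edges. BASIC$(B,\alpha)$, $\alpha\in B\setminus\{\rho\}$, $\rho=\rho(B)$: query $d(v,\alpha)$ for all $v\in B$; put $D(v)=d(v,\alpha)-d(v,\rho)$; partition $B$ into bags $B_1,\dots,B_k$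 according to the distinct values of $D$, ordered by that value. For each $i$ let $u_i\in\arg\min_{v\in B_i}d(v,\alpha)$. If $d(\rho,u_i)+d(u_i,\alpha)=d(\rho,\alpha)$, set $\rho(B_i)=u_i$. Otherwise introduce the latent node $w_i$ connecting the path from $\alpha$ to $\rho$ with $B_i$, add $w_i$ to $B_i$, set $\rho(B_i)=w_i$, and record $d(v,w_i)=\frac12\left(d(v,\alpha)+d(v,\rho)-d(\alpha,\rho)\right)$ for $v\in B_i$. Return $B_1,\dots,B_k$ and the skeleton $\{(\rho(B_1),\rho(B_2)),\dots,(\rho(B_{k-1}),\rho(B_k))\}$. EXPLODE$(B)$: while $|B|>1$, take $u\in B$, $u\ne\rho(B)$; set $B^*=\{v\in B\setminus\{\rho(B)\}: d(u,v)<d(u,\rho(B))+d(v,\rho(B))\}\cup\{\rho(B)\}$ with $\rho(B^* )=\rho(B)$; output $B^*$; replace $B$ by $\{\rho(B)\}\cup(B\setminus B^* )$. BIGSPLIT$(B)$: repeat the following pass until $M\le|B|/\sqrt\Delta$. Pass: sample $u_1,\dots,u_\kappa$ uniformly at random without replacement from $B\setminus\{\rho(B)\}$; set $\mathcal B=\{B\}$, $S=\emptyset$; for $i=1,\dots,\kappa$, find the bag $B^*\in\mathcal B$ containing $u_i$ and, if $u_i\ne\rho(B^* )$, apply BASIC$(B^*,u_i)$, replace $B^*$ in $\mathcal B$ by the bags returned, and add the returned skeleton to $S$; then let $\mathcal C$ be the collection of all bags output by EXPLODE applied to the bags of $\mathcal B$, and let $M$ be the maximal size of a bag in $\mathcal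 C$ ($0$ if there are none). Output $S$ and $\mathcal C$ from the last pass. (Passes use independent randomness.) TREE (with parameter $\kappa$): pick $u\in W$, set $\rho(W)=u$; let $Q$ be a queue containing only the bag $W$; $S=\emptyset$. While $Q$ is nonempty: remove the front bag $B$. If $|B|\le\kappa$, query all $\binom{|B|}{2}$ distances in $B$, find the full set of edges of the tree induced by $B$ and add it to $S$. Otherwise apply BIGSPLIT$(B)$, add its skeleton to $S$ and its output bags to the rear of $Q$. Return $S$. *)

(* Defs.v *)
From HB Require Import structures.
From mathcomp Require Import all_boot all_order all_algebra finmap.
From mathcomp Require Import all_classical all_reals all_analysis.

Set Implicit Arguments.
Unset Strict Implicit.
Unset Printing Implicit Defensive.
Import Order.TTheory GRing.Theory Num.Theory.
Local Open Scope classical_set_scope.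
Local Open Scope fset_scope.
Local Open Scope ring_scope.

Section Trees.
Variables (R : realType) (V : finType) (e : rel V).

(* [size c <= 2] because [:: x; y] is a cycle of the symmetric relation [e]
   for every edge {x, y}. *)
Definition is_tree : Prop :=
  [/\ symmetric e, irreflexive e,
      forall x y : V, connect e x y
    & forall c : seq V, ucycle e c -> (size c <= 2)%N].

Definition degree (v : V) : nat := #|[set w : V | e v w]%SET|.

Definition max_degree : nat := (\max_(v : V) degree v)%N.

Definition semi_labeled_tree (W : {set V}) : Prop :=
  is_tree /\ forall v : V, (degree v <= 2)%N -> v \in W.

(* An edge length is a function of the two endpoints of the edge. *)
Definition edge_lengths (ell : V -> V -> R) : Prop :=
  forall x y : V, e x y -> 0 < ell x y /\ ell x y = ell y x.

Fixpoint path_length (ell : V -> V -> R) (x : V) (p : seq V) : R :=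
  if p is y :: p' then ell x y + path_length ell y p' else 0.

Definition the_path (x y : V) : seq V :=
  xget [::] [set p : seq V | [/\ path e x p, uniq (x :: p) & last x p = y]].

Definition tree_dist (ell : V -> V -> R) (x y : V) : R :=
  path_length ell x (the_path x y).

End Trees.

(* A program can learn a distance only through [Ask], and [run_prog] counts
   every [Ask], including repeated ones. *)
Inductive prog (L R A : Type) : Type :=
| Ret of A
| Ask of L & L & (R -> prog L R A).
Arguments Ret {L R A}.
Arguments Ask {L R A}.

Fixpoint bind_prog (L R A B : Type) (p : prog L R A) (f : A -> prog L R B) :
    prog L R B :=
  match p with
  | Ret a => f a
  | Ask u v k => Ask u v (fun r => bind_prog (k r) f)
  end.

Notation "x <-- p ;; q" := (bind_prog p (fun x => q))
  (at level 100, p at next level, right associativity).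

(* number of queries, result *)
Fixpoint run_prog (L R A : Type) (d : L -> L -> R) (p : prog L R A) : nat * A :=
  match p with
  | Ret a => (0%N, a)
  | Ask u v k => let: (n, a) := run_prog d (k (d u v)) in (n.+1, a)
  end.

(* The algorithm names the regular nodes by their labels, [inl w], and the
   latent nodes it discovers by fresh numbers, [inr i]. *)
Notation node L := (L + nat)%type.

Section Algorithm.
Variables (R : realType) (L : finType).

(* [bdist v] is the recorded distance from [v] to [brep]; it is only read when
   [brep] is latent. *)
Record bag : Type := Bag {
  bset : {fset node L};
  brep : node L;
  bdist : node L -> R }.

Definition bsize (B : bag) : nat := #|` bset B|.

(* Resolves the choices which the algorithm leaves open: an element of an
   argmin in BASIC and the next node in EXPLODE. *)
Variable choice : {fset node L} -> node L.

(* The final branch is only reached for a latent [brep B], when one of the two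
   nodes is [brep B]. *)
Definition get_dist (B : bag) (x y : node L) : prog L R R :=
  match x, y with
  | inl a, inl b => Ask a b Ret
  | _, _ => Ret (if x == y then 0
                 else if y == brep B then bdist B x else bdist B y)
  end.

Fixpoint get_dists (B : bag) (s : seq (node L)) (y : node L) :
    prog L R (node L -> R) :=
  if s is x :: s' then
    r <-- get_dist B x y ;;
    f <-- get_dists B s' y ;;
    Ret (fun z => if z == x then r else f z)
  else Ret (fun=> 0).

(* [c] is the first unused latent name; the result consists of the bags, the
   skeleton and the new first unused name. *)
Definition basic (B : bag) (alpha : node L) (c : nat) :
    prog L R (seq bag * seq (node L * node L) * nat) :=
  let rho := brep B in
  da <-- get_dists B (enum_fset (bset B)) alpha ;;
  dr <-- get_dists B (enum_fset (bset B)) rho ;;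
  let D v := da v - dr v in
  let vals := sort <=%R (undup [seq D v | v <- enum_fset (bset B)]) in
  let mkbag i x :=
    let A := [fset v in bset B | D v == x] in
    let u := choice [fset v in A | all (fun w => da v <= da w) (enum_fset A)] in
    if dr u + da u == da rho then Bag A u (bdist B)
    else Bag (inr i |` A) (inr i) (fun v => (da v + dr v - da rho) / 2) in
  let bags := [seq mkbag ix.1 ix.2 | ix <- zip (iota c (size vals)) vals] in
  let reps := [seq brep B' | B' <- bags] in
  Ret (bags, zip reps (behead reps), (c + size vals)%N).

(* The bags of [bs] are pairwise disjoint, so at most one of them contains a
   given [u]. *)
Fixpoint splits (bs : seq bag) (E : seq (node L * node L)) (c : nat)
    (us : seq (node L)) : prog L R (seq bag * seq (node L * node L) * nat) :=
  if us is u :: us' then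
    if [seq B <- bs | u \in bset B] is B :: _ then
      if u == brep B then splits bs E c us'
      else
        r <-- basic B u c ;;
        let: (bs', E', c') := r in
        splits (bs' ++ [seq B <- bs | u \notin bset B]) (E ++ E') c' us'
    else splits bs E c us'
  else Ret (bs, E, c).

(* The argument [fuel] makes the while loop structural; an iteration removes at
   least one node (the chosen [u]) from the bag. *)
Fixpoint explode_loop (fuel : nat) (B : bag) : prog L R (seq bag) :=
  if fuel is fuel'.+1 then
    if (1 < bsize B)%N then
      let rho := brep B in
      let A := bset B `\ rho in
      let u := choice A in
      du <-- get_dists B (enum_fset A) u ;;
      dr <-- get_dists B (enum_fset A) rho ;;
      let Bs := rho |` [fset v in A | du v < dr u + dr v] in
      Cs <-- explode_loop fuel' (Bag (rho |` (bset B `\` Bs)) rho (bdist B)) ;;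
      Ret (Bag Bs rho (bdist B) :: Cs)
    else Ret [::]
  else Ret [::].

Definition explode (B : bag) : prog L R (seq bag) := explode_loop (bsize B) B.

Fixpoint explode_all (bs : seq bag) : prog L R (seq bag) :=
  if bs is B :: bs' then
    C1 <-- explode B ;; C2 <-- explode_all bs' ;; Ret (C1 ++ C2)
  else Ret [::].

(* One pass of BIGSPLIT(B), for the sample [us]. *)
Definition bigsplit_pass (B : bag) (us : seq (node L)) (c : nat) :
    prog L R (seq bag * seq (node L * node L) * nat) :=
  r <-- splits [:: B] [::] c us ;;
  let: (bs, E, c') := r in
  Cs <-- explode_all bs ;;
  Ret (Cs, E, c').

Definition max_bsize (bs : seq bag) : nat := (\max_(B <- bs) bsize B)%N.

(* The distances between all pairs of distinct nodes of [s]. *)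
Fixpoint dist_table (B : bag) (s : seq (node L)) :
    prog L R (node L -> node L -> R) :=
  if s is x :: s' then
    row <-- get_dists B s' x ;;
    f <-- dist_table B s' ;;
    Ret (fun y z => if y == z then 0 else if y == x then row z
                    else if z == x then row y else f y z)
  else Ret (fun _ _ => 0).

(* The edges of the tree induced by a small bag, computed without any further
   query from the table of all the distances in the bag: splitting with respect
   to every node makes each node the representative of its bag, so that the
   skeleton is the whole induced tree. *)
Definition solve (B : bag) (c : nat) : prog L R (seq (node L * node L) * nat) :=
  tab <-- dist_table B (enum_fset (bset B)) ;;
  let: (_, E, c') :=
    (run_prog (fun a b : L => tab (inl a) (inl b))
      (splits [:: B] [::] c (enum_fset (bset B `\ brep B)))).2 in
  Ret (E, c').

Record state : Type := State {
  queue : seq bag;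
  output : seq (node L * node L);
  fresh : nat;
  nqueries : nat }.

Definition init_state (u : L) : state :=
  State [:: Bag [fset x in [seq (inl w : node L) | w <- enum L]] (inl u)
                (fun=> 0)] [::] 0 0.

(* One step of TREE treats a small bag or performs one pass of BIGSPLIT on the
   front bag, which stays in front of the queue when the pass has to be
   repeated. [smp A] is the sample to be used if this step samples from [A]. *)
Definition step (d : L -> L -> R) (Delta kappa : nat)
    (smp : {fset node L} -> seq (node L)) (st : state) : state :=
  if queue st is B :: Q then
    if (bsize B <= kappa)%N then
      let: (q, (E, c)) := run_prog d (solve B (fresh st)) in
      State Q (output st ++ E) c (nqueries st + q)
    else
      let: (q, (Cs, E, c)) :=
        run_prog d (bigsplit_pass B (smp (bset B `\ brep B)) (fresh st)) in
      if (max_bsize Cs)%:R <= (bsize B)%:R / Num.sqrt (Delta%:R : R) then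
        State (Q ++ Cs) (output st ++ E) c (nqueries st + q)
      else State (B :: Q) (output st) c (nqueries st + q)
  else st.

(* The state of TREE after [t] steps, step number [i] using the sample [smp i]. *)
Fixpoint tree_run (d : L -> L -> R) (Delta kappa : nat) (u : L)
    (smp : nat -> {fset node L} -> seq (node L)) (t : nat) : state :=
  if t is t'.+1 then
    step d Delta kappa (smp t') (tree_run d Delta kappa u smp t')
  else init_state u.

(* TREE stops when the queue is empty; from then on the state is constant. *)
Definition halted (st : state) : Prop := queue st = [::].

Definition total_queries (d : L -> L -> R) (Delta kappa : nat) (u : L)
    (smp : nat -> {fset node L} -> seq (node L)) : \bar R :=
  ereal_sup (range (fun t : nat =>
    ((nqueries (tree_run d Delta kappa u smp t))%:R : R)%:E)).

(* [smp w t A] is the sample to be used if the [t]-th step samples from [A].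
   For any sets [A 0], [A 1], ... the samples are independent, and the [i]-th
   one is uniform among the [#|` A i| ^_ kappa] sequences of [kappa] distinct
   elements of [A i]. *)
Definition uniform_samples (disp : measure_display)
    (Omega : measurableType disp) (P : probability Omega R) (kappa : nat)
    (smp : Omega -> nat -> {fset node L} -> seq (node L)) : Prop :=
  (forall (t : nat) (A : {fset node L}) (us : seq (node L)),
      measurable [set w : Omega | smp w t A = us]) /\
  (forall (N : nat) (A : nat -> {fset node L}) (us : nat -> seq (node L)),
      (forall i, (i < N)%N ->
         [/\ size (us i) = kappa, uniq (us i) & {subset us i <= A i}]) ->
      P [set w : Omega | forall i, (i < N)%N -> smp w i (A i) = us i] =
      (\prod_(i < N) ((#|` A i| ^_ kappa)%:R : R)^-1)%:E).

End Algorithm.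

(* [f] renames the latent nodes found by the algorithm into those of the tree. *)
Definition recovers (V : finType) (e : rel V) (W : {set V})
    (E : seq (node {v : V | v \in W} * node {v : V | v \in W})) : Prop :=
  exists f : node {v : V | v \in W} -> V,
  [/\ forall w : {v : V | v \in W}, f (inl w) = val w,
      {in unzip1 E ++ unzip2 E &, injective f}
    & forall x y : V, e x y <->
        exists2 a, a \in E & (f a.1, f a.2) = (x, y) \/ (f a.1, f a.2) = (y, x)].

(* Main.v *)
Require Import Defs.
From mathcomp Require Import all_boot all_order all_algebra finmap.
From mathcomp Require Import all_classical all_reals all_analysis.
From mathcomp Require Import measurable_realfun.
From mathcomp Require Import ring lra zify.

(** The proof has a deterministic half, about the tree, and a probabilistic
    half, about the sampling.

    The distances of a tree make any three vertices have a median and make the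
    vertices between two given ones linearly ordered; with the description of
    edges as pairs with nothing in between, this is all that is used of the
    tree ([tree_metric]).  While TREE runs, every bag stands for a region of
    the tree, a union of branches hanging off its representative, and holds
    precisely the regular vertices of that region.  The regions of the bags are
    disjoint, and every edge either has been output or touches a region
    ([recovery]).  BASIC cuts a region along the path from the representative to
    the pivot: the value D(v) tells at which vertex of the path v hangs, and
    no vertex of the path is overlooked, since a latent one has a third
    branch, every branch ends in a leaf, and leaves are regular
    ([path_vals], [recovery_basic]).  EXPLODE separates the branches at a
    representative ([explode_step]).  Both hold for every sample, so the output
    is correct as soon as the queue is empty ([recovers_done]).

    A bag returned by a pass on B is an entire branch of the tree that avoids
    the sample and the representative of B.  The branches of this kind that
    contain a given node form a chain, so a node in a returned bag that is too
    large has its least large branch missed by the sample, and whether this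
    happens no longer depends on where the sample cut the tree.  Writing m for
    the number of nodes of B besides its representative, and h for the integer
    part of |B|/sqrt(Delta), Markov's inequality bounds the failure probability
    by (m/h)(1 - h/m)^Delta ([count_fails]), and this is at most 9/10
    ([fail_fraction]).

    Give a bag of size b the potential 70 Delta (b-1)(1 + 2 log_Delta b).  A
    successful pass divides the sizes by sqrt(Delta) and does not increase the
    sum of the b-1, so it lowers the potential by 70 Delta (b-1), while any
    pass makes at most 6 Delta (b-1) queries.  Since a pass succeeds with
    probability at least 1/10, the number of queries plus the potential
    decreases on average by at least 1 in every step before the queue is empty
    ([step_value]).  Hence the expected number of queries is at most the initial
    potential, which is at most 210 Delta n log_Delta n because a tree of maximal
    degree Delta has at least Delta leaves; and the expected number of steps is
    finite, so the queue is almost surely empty at some time. *)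

Set Implicit Arguments.
Unset Strict Implicit.
Unset Printing Implicit Defensive.
Import Order.TTheory GRing.Theory Num.Theory.
Local Open Scope classical_set_scope.
Local Open Scope fset_scope.
Local Open Scope ring_scope.

(** * Paths and distances in a tree *)

Section Paths.
Variables (V : finType) (e : rel V).
Hypothesis tree_e : is_tree e.

Let symE : symmetric e. Proof. by case: tree_e. Qed.

Definition simple_path (x y : V) (p : seq V) :=
  [/\ path e x p, uniq (x :: p) & last x p = y].

Lemma simple_path_exists x y : exists p, simple_path x y p.
Proof.
case: tree_e => _ _ conn _; have /connectP[p pth ->] := conn x y.
by case: (shortenP pth) => q qp qu _; exists q.
Qed.

Lemma split_first (T : eqType) (s : seq T) (P : pred T) : has P s ->
  exists s1 z s2, [/\ s = s1 ++ z :: s2, P z & ~~ has P s1].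
Proof.
move=> hs; exists (take (find P s) s).
have : (find P s < size s)%N by rewrite -has_find.
case: s hs => // x0 s hs lt; exists (nth x0 (x0 :: s) (find P (x0 :: s))).
exists (drop (find P (x0 :: s)).+1 (x0 :: s)); split.
- by rewrite -drop_nth // cat_take_drop.
- exact: nth_find.
- rewrite has_take_leq; last exact: ltnW.
  by rewrite ltnn.
Qed.

(** Two different simple paths with the same ends would close up to a cycle: take
    them from the vertex where they part to the first vertex of the second path
    that lies on the first. *)
Lemma simple_path_unique x y p q : simple_path x y p -> simple_path x y q ->
  p = q.
Proof.
elim: p x q => [|a p IH] x [|b q] //.
- case=> _ _ /= <- [_ /andP[/negP nx _] lq]; case: nx.
  by rewrite -[X in X \in _]lq /= mem_last.
- case=> _ /andP[/negP nx _] lp [_ _ /= xy]; case: nx.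
  by rewrite xy -lp /= mem_last.
case=> pp up lp [pq uq lq].
have [ab|ab] := eqVneq a b.
  subst b; congr (_ :: _); apply: (IH a).
    by split=> //; [case/andP: pp|case/andP: up].
  by split=> //; [case/andP: pq|case/andP: uq].
exfalso.
have : has (mem (a :: p)) (b :: q).
  apply/hasP; exists y; first by rewrite -lq /= mem_last.
  by have : y \in a :: p by rewrite -lp /= mem_last.
case/split_first=> q1 [z [q2 [eq zp nq1]]].
have [r1 [r2 er]] : exists r1 r2, a :: p = r1 ++ z :: r2.
  by case/splitPr: zp => r1 r2; exists r1, r2.
move: pp; rewrite er cat_path /= => /and3P[pr1 er1z _].
move: pq; rewrite eq cat_path /= => /and3P[pq1 eq1z _].
(* forth along the first path up to [z], and back along the second one *)
have : ucycle e (x :: r1 ++ z :: rev q1).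
  rewrite /ucycle; apply/andP; split.
    rewrite /cycle rcons_cat cat_path pr1 /= er1z /=.
    have pxz : path e x (rcons q1 z) by rewrite rcons_path pq1.
    rewrite -rev_cons -(belast_rcons x q1 z) -[X in path e X](last_rcons x q1 z).
    by rewrite rev_path; apply: sub_path pxz => u v /=; rewrite symE.
  move: up; rewrite er => up.
  move: uq; rewrite eq => uq.
  have sub : subseq (x :: r1 ++ [:: z]) (x :: r1 ++ z :: r2).
    by rewrite /= eqxx -[_ ++ z :: r2]/(r1 ++ [:: z] ++ r2) catA prefix_subseq.
  have u1 := subseq_uniq sub up.
  have -> : x :: r1 ++ z :: rev q1 = (x :: r1 ++ [:: z]) ++ rev q1.
    by rewrite /= -catA.
  rewrite cat_uniq u1 rev_uniq andTb.
  apply/andP; split; last first.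
    by move: uq => /= /andP[_]; rewrite cat_uniq => /andP[].
  rewrite has_rev; apply/hasPn => v vq1 /=; apply/negP.
  rewrite inE => /orP[/eqP vx|vr].
    by move: uq => /= /andP[]; rewrite mem_cat -vx vq1.
  move/hasPn: nq1 => /(_ v vq1) /=; rewrite er.
  by move: vr; rewrite !mem_cat !inE => /orP[->//|->]; rewrite orbT.
case: tree_e => _ _ _ acy; move/acy; rewrite /= size_cat /= size_rev.
case: r1 er {pr1 er1z} => [|? ?] //=; last by lia.
case: q1 eq {nq1 pq1 eq1z} => [|? ?] //=.
by case=> bz _ [az _] _; move: ab; rewrite az bz eqxx.
Qed.

Lemma the_pathP x y : simple_path x y (the_path e x y).
Proof.
rewrite /the_path; case: (xgetP [::]) => //= H.
by have [p /H] := simple_path_exists x y.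
Qed.

Lemma the_path_eq x y p : simple_path x y p -> the_path e x y = p.
Proof. exact: simple_path_unique (the_pathP x y). Qed.

Lemma the_path_cat x y z : z \in x :: the_path e x y ->
  the_path e x y = the_path e x z ++ the_path e z y.
Proof.
case: (the_pathP x y); move: (the_path e x y) => p pp up lp.
rewrite inE => /orP[/eqP ->|].
  rewrite (the_path_eq (_ : simple_path x x [::])) //=.
  by symmetry; apply: the_path_eq.
move=> zp; case/path.splitP: zp pp up lp => p1 p2 pp up lp.
rewrite cat_path last_rcons in pp; case/andP: pp => pp1 pp2.
rewrite last_cat last_rcons in lp.
rewrite -cat_cons cat_uniq in up; case/and3P: up => u1 /hasPn h u2.
rewrite (@the_path_eq x z (rcons p1 z)); last by split; rewrite ?last_rcons.
congr (_ ++ _); symmetry; apply: the_path_eq; split=> //=.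
rewrite u2 andbT; apply/negP => /h /negP; apply.
by rewrite /= inE mem_rcons inE eqxx orbT.
Qed.

Lemma the_path_rev x y : the_path e y x = rev (belast x (the_path e x y)).
Proof.
case: (the_pathP x y); move: (the_path e x y) => p pp up lp.
apply: the_path_eq; split.
- rewrite -lp rev_path; by apply: sub_path pp => u v /=; rewrite symE.
- by rewrite -rev_rcons -lp -lastI rev_uniq.
- by case: p {pp up} lp => [|a p] /= // <-; rewrite rev_cons last_rcons.
Qed.

End Paths.

Definition between (R : realType) (V : finType) (d : V -> V -> R) x z y :=
  d x z + d z y == d x y.

(** The properties of the distance of a tree from which everything else follows.
    The linear order of segments has to be postulated besides the medians: they
    alone would also allow the four corners of a rectangle with the city-block
    distance. *)
Record tree_metric (R : realType) (V : finType) (e : rel V) (d : V -> V -> R)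
    : Prop := TreeMetric {
  tm_id : forall x, d x x = 0;
  tm_pos : forall x y, x != y -> 0 < d x y;
  tm_sym : forall x y, d x y = d y x;
  tm_median : forall x y z,
    exists m, [/\ between d x m y, between d y m z & between d x m z];
  tm_linear : forall u w p m, between d u p w -> between d u m w ->
    d u p <= d u m -> between d u p m;
  tm_edge : forall x y,
    e x y <-> x != y /\ forall z, between d x z y -> z = x \/ z = y }.

Section Metric.
Variables (R : realType) (V : finType) (e : rel V) (ell : V -> V -> R).
Hypothesis tree_e : is_tree e.
Hypothesis ell_e : edge_lengths e ell.

Local Notation d := (tree_dist e ell).
Local Notation pa := (the_path e).

Lemma path_length_cat x p q : path_length ell x (p ++ q) =
  path_length ell x p + path_length ell (last x p) q.
Proof. by elim: p x => [|y p IH] x /=; rewrite ?add0r // IH addrA. Qed.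

Lemma path_length_ge0 x p : path e x p -> 0 <= path_length ell x p.
Proof.
elim: p x => [|y p IH] x //= /andP[exy /IH].
by case: (ell_e exy) => h _ h'; apply: addr_ge0 => //; exact: ltW.
Qed.

Lemma path_length_rev x p : path e x p ->
  path_length ell (last x p) (rev (belast x p)) = path_length ell x p.
Proof.
elim: p x => [|y p IH] x //= /andP[exy /IH h].
rewrite rev_cons -cats1 path_length_cat h /= addr0 addrC; congr (_ + _).
case: (ell_e exy) => _ ->; congr ell.
by case: p {h IH} => //= z p; rewrite rev_cons last_rcons.
Qed.

Lemma dist_path_cat x y z : z \in x :: pa x y -> d x y = d x z + d z y.
Proof.
move=> h; rewrite /tree_dist (the_path_cat tree_e h) path_length_cat.
by case: (the_pathP tree_e x z) => _ _ ->.
Qed.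

Lemma dist_id x : d x x = 0.
Proof. by rewrite /tree_dist (the_path_eq tree_e (_ : simple_path e x x [::])). Qed.

Lemma dist_pos x y : x != y -> 0 < d x y.
Proof.
rewrite /tree_dist; case: (the_pathP tree_e x y).
case: (pa x y) => [_ _ /= -> /eqP|z p /= /andP[exz pp] _ _ _] //.
apply: ltr_pwDl; last exact: path_length_ge0.
by case: (ell_e exz).
Qed.

Lemma dist_sym x y : d x y = d y x.
Proof.
rewrite /tree_dist (the_path_rev tree_e x y).
case: (the_pathP tree_e x y) => pp _ lp.
by rewrite -[X in path_length _ X (rev _)]lp path_length_rev.
Qed.

Lemma mem_path_rev a b c : c \in a :: pa a b -> c \in b :: pa b a.
Proof.
rewrite (the_path_rev tree_e a b).
case: (the_pathP tree_e a b); move: (pa a b) => p _ _ <-.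
by rewrite -rev_rcons -lastI mem_rev.
Qed.

Lemma mem_path_last a b : b \in a :: pa a b.
Proof. by case: (the_pathP tree_e a b) => _ _ {1}<-; exact: mem_last. Qed.

(** Follow the path from [z] to [x] up to its first vertex on the path from [x] to
    [y]. *)
Lemma path_median x y z : exists m, [/\ m \in x :: pa x y, m \in y :: pa y z
  & m \in x :: pa x z].
Proof.
have : has (mem (x :: pa x y)) (z :: pa z x).
  apply/hasP; exists x; first exact: mem_path_last.
  by rewrite /= inE eqxx.
case/split_first=> s1 [m [s2 [es mxy ns1]]].
have mzx : m \in z :: pa z x by rewrite es mem_cat inE eqxx orbT.
exists m; split=> //; last exact: mem_path_rev.
apply: mem_path_rev.
case: s1 es ns1 => [|z' s1] [ez es] ns1; first by rewrite ez inE eqxx.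
subst z'; case: (the_pathP tree_e z x); rewrite es => pp up _.
case: (the_pathP tree_e m y) => pq uq lq.
have eqp : pa z y = rcons s1 m ++ pa m y.
  apply: (the_path_eq tree_e); split.
  - rewrite cat_path last_rcons pq andbT rcons_path.
    by move: pp; rewrite cat_path /= => /and3P[-> ->].
  - have -> : z :: rcons s1 m ++ pa m y = (z :: s1) ++ m :: pa m y.
      by rewrite cat_rcons.
    rewrite cat_uniq uq andbT; apply/andP; split.
      by move: up; rewrite -cat_cons cat_uniq => /andP[].
    apply/hasPn=> v vm; apply: (contra _ ns1) => vs.
    apply/hasP; exists v => //=.
    have h := the_path_cat tree_e mxy; rewrite h -cat_cons mem_cat.
    move: vm; rewrite inE => /orP[/eqP->|->]; last by rewrite orbT.
    by rewrite mem_path_last.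
  - by rewrite last_cat last_rcons.
by rewrite eqp inE mem_cat mem_rcons inE eqxx orbT.
Qed.

Local Notation btw := (between d).

(** The median of [x], [y] and [z] is at distance 0 from [z] if the triangle
    inequality through [z] is an equality. *)
Lemma btw_path x y z : btw x z y = (z \in x :: pa x y).
Proof.
apply/idP/idP; last by move/dist_path_cat => h; apply/eqP.
move=> /eqP h; have [m [mxy myz mxz]] := path_median x y z.
have h1 := dist_path_cat mxy; have h2 := dist_path_cat myz.
have h3 := dist_path_cat mxz.
have [<-//|/dist_pos h4] := eqVneq m z.
rewrite (dist_sym z y) in h.
rewrite (dist_sym m y) in h1.
lra.
Qed.

Lemma btw_median x y z : exists m, [/\ btw x m y, btw y m z & btw x m z].
Proof.
by have [m [*]] := path_median x y z; exists m; split; rewrite btw_path.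
Qed.

Lemma btw_linear u w p m : btw u p w -> btw u m w -> d u p <= d u m ->
  btw u p m.
Proof.
rewrite !btw_path => hp hm; move: hp; rewrite (the_path_cat tree_e hm).
rewrite -cat_cons mem_cat => /orP[//|pm] le.
have pmw : p \in m :: pa m w by rewrite inE pm orbT.
have h1 := dist_path_cat pmw; have h2 := dist_path_cat hm.
have hp : btw u p w.
  by rewrite btw_path (the_path_cat tree_e hm) -cat_cons mem_cat pm orbT.
move/eqP: hp => h3.
have [<-|/dist_pos h4] := eqVneq p m; first exact: mem_path_last.
by exfalso; rewrite dist_sym in h4; lra.
Qed.

Lemma edge_btw x y : e x y <-> x != y /\ forall z, btw x z y -> z = x \/ z = y.
Proof.
case: (tree_e) => _ irr _ _.
split=> [exy|[xy H]].
  have nxy : x != y by apply: contraTneq exy => ->; rewrite irr.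
  split=> // z; rewrite btw_path (the_path_eq tree_e (_ : simple_path e x y [:: y])).
    by rewrite !inE => /orP[]/eqP; [left|right].
  by split; rewrite /= ?exy // inE nxy.
move: (the_pathP tree_e x y) H; case E: (pa x y) => [|z p] [pp up lp] H.
  by rewrite -lp eqxx in xy.
have : btw x z y by rewrite btw_path E !inE eqxx orbT.
move: pp up => /= /andP[exz _] /andP[]; rewrite inE negb_or => /andP[xz _] _.
by case/H=> zz; move: xz exz; rewrite zz ?eqxx.
Qed.

Lemma tree_distP : tree_metric e d.
Proof.
split; [exact: dist_id|exact: dist_pos|exact: dist_sym|exact: btw_median
       |exact: btw_linear|exact: edge_btw].
Qed.
End Metric.

(** * Betweenness and branches *)

Section TreeMetric.
Variables (R : realType) (V : finType) (e : rel V) (d : V -> V -> R).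
Hypothesis dm : tree_metric e d.
Local Notation btw := (between d).

Lemma tm_tri x y z : d x y <= d x z + d z y.
Proof.
have [m [/eqP h1 /eqP h2 /eqP h3]] := tm_median dm x y z.
have sm := tm_sym dm; rewrite (sm y m) (sm y z) in h2.
have ge0 a b : 0 <= d a b.
  by have [->|/(tm_pos dm)/ltW//] := eqVneq a b; rewrite (tm_id dm).
have := ge0 m z; lra.
Qed.

Lemma tm_ge0 x y : 0 <= d x y.
Proof.
by have [->|/(tm_pos dm)/ltW//] := eqVneq x y; rewrite (tm_id dm).
Qed.

Lemma tm_eq0 x y : d x y = 0 -> x = y.
Proof.
by move=> h; apply/eqP; apply: contraT => /(tm_pos dm); rewrite h ltxx.
Qed.

Lemma btw_sym x y z : btw x z y = btw y z x.
Proof.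
by rewrite /between (tm_sym dm y z) (tm_sym dm z x) addrC
  (tm_sym dm x y).
Qed.

Lemma btw_left x y : btw x x y.
Proof. by rewrite /between (tm_id dm) add0r. Qed.

Lemma btw_right x y : btw x y y.
Proof. by rewrite /between (tm_id dm) addr0. Qed.

Hint Resolve btw_left btw_right : core.

Lemma btw_trans x w z y : btw x z y -> btw x w z -> btw x w y.
Proof.
move=> /eqP h1 /eqP h2; apply/eqP.
have := tm_tri x y w; have := tm_tri w y z; lra.
Qed.

Lemma btw_transl x w z y : btw x z y -> btw x w z -> btw w z y.
Proof.
move=> /eqP h1 /eqP h2; apply/eqP.
have := tm_tri x y w; have := tm_tri w y z; lra.
Qed.

Lemma btw_transr x w z y : btw x z y -> btw z w y -> btw x w y.
Proof. by rewrite !(btw_sym _ y) => h1 h2; apply: btw_trans h1 h2. Qed.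

Lemma btw_same x y : btw x y x -> y = x.
Proof.
move=> /eqP; rewrite (tm_id dm) (tm_sym dm y) => h.
by have [//|/(tm_pos dm)] := eqVneq y x; rewrite (tm_sym dm) => h2; exfalso; lra.
Qed.

Lemma btw_anti x y z : btw x y z -> btw x z y -> y = z.
Proof.
move=> /eqP h1 /eqP h2; apply: tm_eq0.
have := tm_ge0 y z; rewrite (tm_sym dm z y) in h2; lra.
Qed.

Lemma btw_total u w p m : btw u p w -> btw u m w -> btw u p m \/ btw u m p.
Proof.
move=> h1 h2; case: (leP (d u p) (d u m)) => [|/ltW] h.
  by left; apply: (tm_linear dm) h1 h2 h.
by right; apply: (tm_linear dm) h2 h1 h.
Qed.

Lemma btw_inj u w p m : btw u p w -> btw u m w -> d u p = d u m -> p = m.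
Proof.
by move=> h1 h2 h; apply: (@btw_anti u);
  [apply: (tm_linear dm) h1 h2 _|apply: (tm_linear dm) h2 h1 _]; rewrite h.
Qed.

(** The median of [u], [w] and [v] cuts the segment from [u] to [w] into a part of
    the segment from [u] to [v] and a part of the one from [v] to [w].  This is
    the transitivity of [same_branch] below. *)
Lemma btw_or p u v w : btw u p w -> btw u p v \/ btw v p w.
Proof.
move=> h; have [m [h1 h2 h3]] := tm_median dm u w v.
case: (btw_total h h1) => k.
  by left; apply: btw_trans k.
right; rewrite btw_sym in h2.
by apply: btw_transr h2 _; apply: btw_transl k.
Qed.

(** For vertices other than [q], this is being in the same component of the tree
    without [q]. *)
Definition same_branch (q v w : V) := ~~ btw v q w.
Local Notation br := same_branch.

Lemma branch_refl q v : v != q -> br q v v.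
Proof. by apply: contra => /btw_same ->. Qed.

Lemma branch_sym q v w : br q v w = br q w v.
Proof. by rewrite /same_branch btw_sym. Qed.

Lemma branch_trans q v u w : br q u v -> br q v w -> br q u w.
Proof.
move=> h1 h2; apply/negP => /(btw_or v)[]; first exact/negP.
exact/negP.
Qed.

Lemma branch_neq q v w : br q v w -> v != q.
Proof. by apply: contra => /eqP->. Qed.

(** Nestedness is what makes the branches containing a given vertex a chain, the
    key to the analysis of the sampling. *)
Lemma branch_nested p q q' v : btw p q v -> btw p q' v -> btw p q q' ->
  forall w, br q' v w -> br q v w.
Proof.
move=> h1 h2 h3 w; apply: contra => h4.
have h5 : btw v q' q by rewrite btw_sym; apply: btw_transl h2 h3.
exact: btw_trans h4 h5.
Qed.

Lemma neighbor_toward q v : v != q ->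
  exists y, [/\ e q y, btw q y v & br q v y].
Proof.
move=> vq.
have Pv : (v != q) && btw q v v by rewrite vq /=.
case: (@arg_minP _ _ _ v (fun z => (z != q) && btw q z v) (d q) Pv) => y /andP[yq hy] ymin.
exists y; split=> //.
- apply/(tm_edge dm); split; first by rewrite eq_sym.
  move=> z hz; have [->|zq] := eqVneq z q; [by left|right].
  have hz' := btw_trans hy hz.
  have := ymin z; rewrite zq hz' => /(_ isT) le.
  by apply: (@btw_anti q) hz _; apply: (tm_linear dm) hy hz' le.
- apply/negP => h; rewrite btw_sym in hy; move: yq.
  by rewrite (btw_anti h hy) eqxx.
Qed.

Lemma neighbor_toward_unique a m y y' : e m y -> e m y' ->
  br m a y -> br m a y' -> y = y'.
Proof.
suff main z : e m z -> br m a z -> btw a z m.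
  move=> e1 e2 b1 b2; have h1 := main _ e1 b1; have h2 := main _ e2 b2.
  rewrite !(btw_sym a) in h1 h2.
  have aux u v : e m u -> e m v -> btw m u v -> u = v.
    move=> eu ev h; case/(tm_edge dm): ev => _ /(_ _ h)[um|//].
    by case/(tm_edge dm): eu; rewrite um eqxx.
  by case: (btw_total h1 h2) => [/aux->|/aux->].
move=> ez bz; have [q [h1 h2 h3]] := tm_median dm a m z.
case/(tm_edge dm): ez => _ /(_ q h2)[qm|<-//].
by move: bz; rewrite /same_branch -qm h3.
Qed.

Lemma btw_concat a m y w : y != m -> btw a m y -> btw m y w -> btw a m w.
Proof.
move=> ym h1 h2; apply: contraT => h3.
have b1 : br m w y.
  apply/negP => h; rewrite btw_sym in h2; move: ym.
  by rewrite (btw_anti h h2) eqxx.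
have := branch_trans h3 b1; by rewrite /same_branch h1.
Qed.

Lemma edge_neq x y : e x y -> x != y.
Proof. by case/(tm_edge dm). Qed.

Variable W : {set V}.
Hypothesis low_degree : forall v, (degree e v <= 2)%N -> v \in W.

(** A vertex farthest from [p] among those beyond [v] is a leaf: each of its
    neighbors is on the side of [p], and there is only one such neighbor. *)
Lemma regular_beyond p v : exists2 w, w \in W & btw p v w.
Proof.
case: (@arg_maxP _ _ _ v (btw p v) (d p) (btw_right p v)) => w hw wmax.
exists w => //; apply: low_degree.
apply: (@leq_trans 1%N) => //; apply/card_le1_eqP => y y'.
suff main z : z \in [set y | e w y]%SET -> br w p z.
  move=> h1 h2; have b1 := main _ h1; have b2 := main _ h2.
  rewrite !inE in h1 h2; exact: neighbor_toward_unique b2 b1.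
rewrite inE => ez; apply/negP => h.
have : d p z <= d p w := wmax z (btw_trans h hw); rewrite -(eqP h) leNgt.
by rewrite ltrDl (tm_pos dm) // edge_neq.
Qed.

(** A latent vertex has at least three neighbors, of which only one points to [a]
    and only one to [b]. *)
Lemma regular_third_branch a b m : m \notin W ->
  exists2 w, w \in W & btw a m w /\ btw b m w.
Proof.
move=> mW.
have : (3 <= degree e m)%N.
  by rewrite ltnNge; apply: contra mW; exact: low_degree.
have card1 c : (#|[set y in [set y | e m y] | br m c y]%SET| <= 1)%N.
  apply/card_le1_eqP => y y'; rewrite !inE => /andP[e1 b1] /andP[e2 b2].
  exact: neighbor_toward_unique b2 b1.
rewrite /degree; set N := [set y | e m y]%SET => deg.
have [y yN] : exists y, y \in (N :\: [set y in N | br m a y] :\: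
    [set y in N | br m b y])%SET.
  apply/set0Pn; rewrite -card_gt0 cardsD.
  have := card1 a; have := card1 b.
  have := subset_leq_card (finset.subsetIr (N :\: [set y in N | br m a y])
     [set y in N | br m b y])%SET.
  rewrite cardsD.
  have := subset_leq_card (finset.subsetIr N [set y in N | br m a y])%SET.
  by move: deg; rewrite -/N; lia.
move: yN; rewrite !inE => /and3P[].
rewrite !negb_and !negbK => h1 h2 emy.
rewrite emy /= in h1 h2.
have [w wW hw] := regular_beyond m y.
have ym : y != m by rewrite eq_sym edge_neq.
by exists w => //; split; apply: btw_concat hw.
Qed.

(** Distinct branches at a vertex of maximal degree contain distinct regular
    vertices. *)
Lemma max_degree_le_regular : (max_degree e <= #|W|)%N.
Proof.
apply/bigmax_leqP => p _; rewrite /degree.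
have /choice [g gP] : forall y, exists w, w \in W /\ btw p y w.
  by move=> y; have [w] := regular_beyond p y; exists w.
rewrite -(card_in_imset (f := g)); last first.
  move=> y y'; rewrite !inE => ey ey' eg.
  have b z : e p z -> br p (g z) z.
    move=> ez; apply/negP => h; case: (gP z) => _ h'.
    rewrite btw_sym in h'; move: (edge_neq ez).
    by rewrite (btw_anti h h') eqxx.
  have b2 := b _ ey'; rewrite -eg in b2.
  exact: neighbor_toward_unique ey ey' (b _ ey) b2.
apply: subset_leq_card; apply/fintype.subsetP => _ /imsetP[y _ ->].
by case: (gP y).
Qed.
End TreeMetric.

(** * Lists and query programs *)

Section ListFacts.

Lemma map_zip_iota (T : eqType) (U : Type) (g : nat -> T -> U) c (s : seq T) :
  uniq s ->
  [seq g ix.1 ix.2 | ix <- zip (iota c (size s)) s] =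
  [seq g (c + index x s)%N x | x <- s].
Proof.
elim: s c => //= x s IH c /andP[xs us]; rewrite eqxx addn0 IH //.
congr cons; apply/eq_in_map => y ys; case: eqP => [xy|_].
  by rewrite xy ys in xs.
by rewrite addSnnS.
Qed.

Lemma zip_map_behead (T U : Type) (g : T -> U) (s : seq T) :
  zip (map g s) (behead (map g s)) =
  [seq (g ab.1, g ab.2) | ab <- zip s (behead s)].
Proof. by case: s => //= x s; elim: s x => //= y s IH x; rewrite IH. Qed.

Lemma mem_zip_behead disp (T : orderType disp) (s : seq T) (a b : T) :
  sorted <%O s ->
  (a, b) \in zip s (behead s) <->
  [/\ a \in s, b \in s, (a < b)%O & forall c, c \in s -> ~~ ((a < c)%O && (c < b)%O)].
Proof.
case: s => [|x s] /=; first by move=> _; split=> // -[].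
elim: s x => [|y s IH] x.
  move=> _; split=> // -[]; rewrite !inE => /eqP-> /eqP->.
  by rewrite ltxx.
rewrite [path _ _ _]/= => /andP[xy py]; have {}IH := IH _ py.
have xmin z : z \in y :: s -> (x < z)%O.
  rewrite inE => /orP[/eqP->//|zs]; apply: (lt_trans xy).
  by move: py; rewrite lt_path_sortedE => /andP[/allP/(_ _ zs)].
have ymin z : z \in y :: s -> (y <= z)%O.
  rewrite inE => /orP[/eqP->//|zs]; apply: ltW.
  by move: py; rewrite lt_path_sortedE => /andP[/allP/(_ _ zs)].
rewrite [zip _ _]/= inE; split=> [/orP[/eqP[-> ->]|/IH[as_ bs ab H]]|].
- split; rewrite ?inE ?eqxx ?orbT //= => c; rewrite inE.
  move=> /orP[/eqP->|/ymin]; first by rewrite ltxx.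
  by move=> h; apply/negP=> /andP[_]; rewrite ltNge h.
- split=> //; rewrite 1?inE ?as_ ?bs ?orbT // => c.
  rewrite inE => /orP[/eqP->|/H//]; apply/negP=> /andP[ax _].
  by have := lt_trans ax (xmin _ as_); rewrite ltxx.
case; rewrite inE => /orP[/eqP->|as_] bs ab H.
  have {}bs : b \in y :: s.
    by move: bs; rewrite inE => /orP[/eqP bx|//]; rewrite bx ltxx in ab.
  have := H y; rewrite !inE eqxx orbT xy /= => /(_ isT).
  rewrite -leNgt => by_; apply/orP; left.
  by rewrite (@le_anti _ _ b y) // by_ ymin.
have {}bs : b \in y :: s.
  move: bs; rewrite inE => /orP[/eqP bx|//].
  by rewrite bx in ab; have := lt_trans ab (xmin _ as_); rewrite ltxx.
apply/orP; right; apply/IH; split=> // c cs; apply: H.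
by rewrite inE cs orbT.
Qed.

(** Bags contain functions and have no decidable equality, so the membership
    predicate of sequences does not apply to sequences of bags. *)
Definition every T (P : T -> Prop) (s : seq T) := all (fun x => `[< P x >]) s.

Lemma every_cons T (P : T -> Prop) x s : every P (x :: s) <-> P x /\ every P s.
Proof.
rewrite /every /=; split=> [/andP[/asboolP]//|[? ?]].
by apply/andP; split=> //; apply/asboolP.
Qed.

Lemma every_cat T (P : T -> Prop) s t : every P (s ++ t) <-> every P s /\ every P t.
Proof. by rewrite /every all_cat; split=> [/andP|[-> ->]]. Qed.

Lemma every_imp T (P Q : T -> Prop) s : (forall x, P x -> Q x) ->
  every P s -> every Q s.
Proof. by move=> H; apply: sub_all => x /asboolP/H/asboolP. Qed.

Lemma every_and T (P Q : T -> Prop) s : every P s -> every Q s ->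
  every (fun x => P x /\ Q x) s.
Proof.
elim: s => // x s IH /every_cons[h1 h2] /every_cons[h3 h4].
by apply/every_cons; split=> //; exact: IH.
Qed.

Lemma every_map (I : eqType) T (P : T -> Prop) (g : I -> T) s :
  (forall i, i \in s -> P (g i)) -> every P (map g s).
Proof.
by move=> H; rewrite /every all_map; apply/allP => i /H Pi /=; apply/asboolP.
Qed.

Lemma every_filter T (P : T -> Prop) (a : pred T) s :
  every P s -> every P [seq x <- s | a x].
Proof.
elim: s => //= x s IH /every_cons[h1 h2]; case: (a x); last exact: IH.
by apply/every_cons; split=> //; exact: IH.
Qed.

End ListFacts.

Section Programs.
Variables (L : eqType) (R A B : Type) (d : L -> L -> R).

Definition result A (p : prog L R A) := (run_prog d p).2.
Definition cost A (p : prog L R A) := (run_prog d p).1.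

Lemma run_bind (p : prog L R A) (f : A -> prog L R B) :
  run_prog d (bind_prog p f) =
  ((cost p + cost (f (result p)))%N, result (f (result p))).
Proof.
rewrite /cost /result; elim: p => [a|u v k IH] /=; first by case: run_prog.
by rewrite IH; case: (run_prog d (k _)).
Qed.

Lemma result_bind (p : prog L R A) (f : A -> prog L R B) :
  result (bind_prog p f) = result (f (result p)).
Proof. by rewrite {1}/result run_bind. Qed.

Lemma cost_bind (p : prog L R A) (f : A -> prog L R B) :
  cost (bind_prog p f) = (cost p + cost (f (result p)))%N.
Proof. by rewrite {1}/cost run_bind. Qed.

Lemma result_ret (a : A) : result (Ret a) = a. Proof. by []. Qed.

Lemma cost_ret (a : A) : cost (Ret a) = 0%N. Proof. by []. Qed.

End Programs.

Section Distances.
Variables (R : realType) (L : finType) (dd : L -> L -> R).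

Definition is_regular (x : node L) := if x is inl _ then true else false.

Lemma result_get_dists (B : bag R L) s y z : z \in s ->
  result dd (get_dists B s y) z = result dd (get_dist B z y).
Proof.
elim: s => //= x s IH; rewrite !result_bind inE /result /= -/(result _ _) => zs.
by case: eqP zs => [->|_ /IH].
Qed.

Lemma cost_get_dist (B : bag R L) x y :
  cost dd (get_dist B x y) = (is_regular x && is_regular y).
Proof. by case: x y => [a|a] [b|b]. Qed.

Lemma cost_get_dists (B : bag R L) s y :
  (cost dd (get_dists B s y) <= count is_regular s)%N.
Proof.
elim: s => //= x s IH; rewrite !cost_bind {3}/cost /= addn0 cost_get_dist.
by apply: leq_add => //; case: is_regular => //=; case: is_regular.
Qed.

End Distances.
Arguments is_regular {L} x.
Arguments every : simpl never.

(** * Bags and their regions *)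

Section Bags.
Variables (R : realType) (V : finType) (e : rel V) (W : {set V}).
Variables (d : V -> V -> R).
Hypothesis dm : tree_metric e d.
Hypothesis low_degree : forall v, (degree e v <= 2)%N -> v \in W.
Local Notation L := {v : V | v \in W}.
Local Notation btw := (between d).
Local Notation br := (same_branch d).

(** The region is recovered from the regular nodes of the bag: it consists of the
    vertices that share a branch at the representative with one of them.  Hence
    it is a function of the bag, and needs no bookkeeping of its own. *)
Definition region (f : node L -> V) (B : bag R L) : {set V} :=
  [set v | [exists w : L, [&& inl w \in bset B, inl w != brep B
     & br (f (brep B)) v (val w)]]]%SET.

(** The naming [f] sends nodes to vertices; the names of latent nodes below [c]
    are in use. *)
Record represents (f : node L -> V) (c : nat) (B : bag R L) (K : {set V}) : Prop :=
  Represents {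
  bag_rep : brep B \in bset B;
  bag_fresh : forall i, brep B = inr i -> (i < c)%N;
  bag_notin : f (brep B) \notin K;
  bag_closed : forall v w, v \in K -> br (f (brep B)) v w -> w \in K;
  bag_mem : forall x, x \in bset B -> x != brep B ->
    exists2 w : L, x = inl w & val w \in K;
  bag_reg : forall w : L, val w \in K -> inl w \in bset B;
  bag_dist : forall x, x \in bset B -> x != brep B -> ~~ is_regular (brep B) ->
    bdist B x = d (f x) (f (brep B)) }.

Definition labels (f : node L -> V) := forall w : L, f (inl w) = val w.

(** Each branch in [K] contains a regular vertex, so that no part of [K] is
    invisible in the bag. *)
Lemma bag_region f c B K : labels f -> represents f c B K -> region f B = K.
Proof.
move=> lab g; apply/setP => v; rewrite inE; apply/existsP/idP.
  move=> [w /and3P[wB wr h]]; have [w' [ww] wK] := bag_mem g wB wr.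
  by apply: (bag_closed g wK); rewrite -ww (branch_sym dm).
move=> vK.
have [w wW h] := regular_beyond dm low_degree (f (brep B)) v.
have vp : v != f (brep B) by apply: contraNneq (bag_notin g) => <-.
have hb : br (f (brep B)) v w.
  apply/negP => h'; rewrite (btw_sym dm) in h'; rewrite (btw_sym dm) in h.
  by move: vp; rewrite (btw_anti dm h h') eqxx.
have wK := bag_closed g vK hb.
exists (exist _ w wW); apply/and3P; split=> //.
  exact: (bag_reg g).
by apply: contraNneq (bag_notin g) => <-; rewrite lab.
Qed.

Lemma bag_mem_region f c B : labels f -> represents f c B (region f B) ->
  forall x, (x \in bset B `\ brep B) =
    (if x is inl w then val w \in region f B else false).
Proof.
move=> lab g x; rewrite in_fsetD1; apply/idP/idP.
  by move=> /andP[xr xB]; have [w -> wK] := bag_mem g xB xr.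
case: x => // w wK; rewrite (bag_reg g wK) andbT.
by apply: contraTneq wK => wr; move: (bag_notin g); rewrite -wr lab.
Qed.

(** The oracle need not be the distance: the computation on a small bag answers its
    queries from a table, which is right only inside the bag. *)
Definition agree (dd : L -> L -> R) (B : bag R L) :=
  forall a b : L, inl a \in bset B -> inl b \in bset B ->
  dd a b = d (val a) (val b).

Lemma get_distE dd f c B K x y : labels f -> represents f c B K -> agree dd B ->
  x \in bset B -> y \in bset B -> (y == brep B) || is_regular y ->
  result dd (get_dist B x y) = d (f x) (f y).
Proof.
move=> lab g ag xB yB hy.
have reg z : z \in bset B -> z != brep B -> is_regular z.
  by move=> zB zr; have [w ->] := bag_mem g zB zr.
rewrite /result; case: x y xB yB hy => [a|i] [b|j] xB yB hy /=.
- by rewrite ag // !lab.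
- rewrite orbF in hy; rewrite hy (bag_dist g) -?(eqP hy) //.
- have ir : inr i == brep B by apply: contraT => /(reg _ xB).
  have br_ : inl b != brep B by rewrite -(eqP ir).
  rewrite (negPf br_) (bag_dist g) // -?(eqP ir) // (tm_sym dm).
  by rewrite (eqP ir).
- have ir : inr i == brep B by apply: contraT => /(reg _ xB).
  rewrite orbF in hy; rewrite (eqP ir) (eqP hy) eqxx.
  by rewrite (tm_id dm).
Qed.

Lemma bag_inj f c B K : labels f -> represents f c B K -> {in bset B &, injective f}.
Proof.
move=> lab g x y xB yB fxy.
have [xr|xr] := eqVneq x (brep B); have [yr|yr] := eqVneq y (brep B).
- by rewrite xr yr.
- have [w ew wK] := bag_mem g yB yr; move: (bag_notin g).
  by rewrite -xr fxy ew lab wK.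
- have [w ew wK] := bag_mem g xB xr; move: (bag_notin g).
  by rewrite -yr -fxy ew lab wK.
have [w ew wK] := bag_mem g xB xr; have [w' ew' wK'] := bag_mem g yB yr.
by move: fxy; rewrite ew ew' !lab => /val_inj->.
Qed.

Lemma bag_ext f f' c c' B K : (forall x, is_regular x \/ x = brep B -> f' x = f x) ->
  (c <= c')%N -> represents f c B K -> represents f' c' B K.
Proof.
move=> ff cc g; have fr := ff _ (or_intror (erefl _)).
split; rewrite ?fr; try by case: g.
  by move=> i /(bag_fresh g) /leq_trans; exact.
move=> x xB xr nr; rewrite (bag_dist g) //.
by have [w ew _] := bag_mem g xB xr; rewrite ff // ew; left.
Qed.

Lemma region_ext f f' B : f' (brep B) = f (brep B) -> region f' B = region f B.
Proof. by move=> h; rewrite /region h. Qed.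
End Bags.

(** * BASIC cuts a region along a path *)

Section BasicBags.
Variables (R : realType) (L : finType).
Variable choice : {fset node L} -> node L.

Definition basic_bag_at (B : bag R L) (da dr : node L -> R) (i : nat) (x : R) :=
  let A := [fset v in bset B | da v - dr v == x] in
  let u := choice [fset v in A | all (fun w => da v <= da w) (enum_fset A)] in
  if dr u + da u == da (brep B) then Bag A u (bdist B)
  else Bag (inr i |` A) (inr i) (fun v => (da v + dr v - da (brep B)) / 2).

(** The position of the value [x] in [vals] determines the fresh name of the
    bag, which makes the bag a function of [x] alone. *)
Definition basic_bag B da dr c (vals : seq R) x :=
  basic_bag_at B da dr (c + index x vals) x.

Lemma basicE dd (B : bag R L) alpha c :
  let da := result dd (get_dists B (enum_fset (bset B)) alpha) in
  let dr := result dd (get_dists B (enum_fset (bset B)) (brep B)) in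
  let vals := sort <=%R (undup [seq da v - dr v | v <- enum_fset (bset B)]) in
  let bg := basic_bag B da dr c vals in
  result dd (basic choice B alpha c) =
  (map bg vals,
   [seq (brep (bg ab.1), brep (bg ab.2)) | ab <- zip vals (behead vals)],
   (c + size vals)%N).
Proof.
move=> da dr vals bg; rewrite /basic !result_bind {1}/result /=.
rewrite -/da -/dr -/vals.
have -> : [seq (brep (bg ab.1), brep (bg ab.2)) | ab <- zip vals (behead vals)] =
    zip (map (@brep R L) (map bg vals)) (behead (map (@brep R L) (map bg vals))).
  by rewrite -map_comp zip_map_behead.
have -> // : map bg vals =
  [seq basic_bag_at B da dr ix.1 ix.2 | ix <- zip (iota c (size vals)) vals].
by rewrite map_zip_iota // sort_uniq undup_uniq.
Qed.

Lemma cost_basic dd (B : bag R L) alpha c :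
  (cost dd (basic choice B alpha c) <=
   2 * count is_regular (enum_fset (bset B)))%N.
Proof.
rewrite /basic !cost_bind mul2n -addnn [X in (_ + (_ + X))%N]/cost /= addn0.
by apply: leq_add; exact: cost_get_dists.
Qed.
End BasicBags.

Definition overlap (R : realType) (V : finType) (W : {set V}) (d : V -> V -> R)
    (f : node {v : V | v \in W} -> V) (bs : seq (bag R {v : V | v \in W})) v :=
  count (fun B => v \in region d f B) bs.

(** The nodes discovered so far. *)
Definition nodes (R : realType) (L : finType) (E : seq (node L * node L))
    (bs : seq (bag R L)) : seq (node L) :=
  unzip1 E ++ unzip2 E ++ map (@brep R L) bs.

(** The invariant of the reconstruction, for pending bags [bs], output edges [E] and
    first unused name [c].  It depends on the regions only through the number of
    bags covering a vertex, which makes it easy to transport from one list of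
    bags to another. *)
Record recovery (R : realType) (V : finType) (e : rel V) (W : {set V})
    (d : V -> V -> R) (f : node {v : V | v \in W} -> V)
    (bs : seq (bag R {v : V | v \in W}))
    (E : seq (node {v : V | v \in W} * node {v : V | v \in W})) (c : nat)
    : Prop := Recovery {
  recovery_labels : labels f;
  recovery_bags : every (fun B => represents d f c B (region d f B)) bs;
  recovery_disjoint : forall v, (overlap d f bs v <= 1)%N;
  recovery_inj : {in nodes E bs &, injective f};
  recovery_avoid : forall x, x \in nodes E bs -> overlap d f bs (f x) = 0%N;
  recovery_fresh : forall i, inr i \in nodes E bs -> (i < c)%N;
  recovery_edge : forall a, a \in E -> e (f a.1) (f a.2);
  recovery_cover : forall x y, e x y ->
    (exists2 a, a \in E & (f a.1, f a.2) = (x, y) \/ (f a.1, f a.2) = (y, x))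
    \/ (0 < overlap d f bs x + overlap d f bs y)%N }.

Section BasicGeometry.
Variables (R : realType) (V : finType) (e : rel V) (W : {set V}).
Variables (d : V -> V -> R).
Hypothesis dm : tree_metric e d.
Hypothesis low_degree : forall v, (degree e v <= 2)%N -> v \in W.
Local Notation L := {v : V | v \in W}.
Local Notation btw := (between d).
Local Notation br := (same_branch d).
Variable choice : {fset node L} -> node L.
Hypothesis choice_in : forall A, A != fset0 -> choice A \in A.

Variables (f : node L -> V) (c : nat) (B : bag R L) (K : {set V}).
Variables (dd : L -> L -> R) (a : L).
Hypotheses (lab : labels f) (gB : represents d f c B K) (ag : agree d dd B).
Hypotheses (aB : inl a \in bset B) (ar : inl a != brep B).

Let rho := brep B.
Let p := f rho.
Let da := result dd (get_dists B (enum_fset (bset B)) (inl a)).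
Let dr := result dd (get_dists B (enum_fset (bset B)) rho).
Let vals := sort <=%R (undup [seq da v - dr v | v <- enum_fset (bset B)]).
Let bg := basic_bag choice B da dr c vals.
Let va := val a.

(** On the path, this equals the distance from [p] to [va] minus twice the distance
    from [p] to [j]: it determines [j], and increases from [va] to [p]. *)
Definition path_key (j : V) := d j va - d j p.
Let key := path_key.

Lemma basic_da x : x \in bset B -> da x = d (f x) va.
Proof.
move=> xB; rewrite /da result_get_dists // (get_distE dm lab gB ag) //.
  by rewrite lab.
by rewrite orbT.
Qed.

Lemma basic_dr x : x \in bset B -> dr x = d (f x) p.
Proof.
move=> xB; rewrite /dr result_get_dists // (get_distE dm lab gB ag) //.
  exact: (bag_rep gB).
by rewrite eqxx.
Qed.

Let rhoB : rho \in bset B. Proof. exact: (bag_rep gB). Qed.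

Let vaK : va \in K.
Proof. by have [w [<-]] := bag_mem gB aB ar. Qed.

Lemma path_in_region j : btw p j va -> j != p -> j \in K.
Proof.
move=> h jp; apply: (bag_closed gB vaK); apply/negP => h'.
rewrite (btw_sym dm) in h'; rewrite (btw_sym dm) in h'.
rewrite (btw_sym dm) in h; move: jp.
by rewrite (btw_anti dm h h') eqxx.
Qed.

Lemma path_key_inj j j' : btw p j va -> btw p j' va -> key j = key j' -> j = j'.
Proof.
move=> h h' kk; apply: (btw_inj dm h h').
move/eqP: h => h; move/eqP: h' => h'; rewrite /key /path_key in kk.
rewrite (tm_sym dm p j) (tm_sym dm p j') in h h' *; lra.
Qed.

(** The median is the vertex of the path at which [v] hangs. *)
Lemma path_projection v : exists j, [/\ btw p j va, btw p j v & btw va j v].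
Proof. by have [j [h1 h2 h3]] := tm_median dm p va v; exists j. Qed.

Lemma projection_key j v : btw p j v -> btw va j v -> d v va - d v p = key j.
Proof.
move=> /eqP h1 /eqP h2; rewrite /key /path_key.
rewrite (tm_sym dm v va) (tm_sym dm v p) -h1 -h2.
by rewrite (tm_sym dm j va) (tm_sym dm j p); lra.
Qed.

Lemma mem_vals x :
  x \in vals <-> exists2 y, y \in bset B & x = da y - dr y.
Proof.
rewrite /vals mem_sort mem_undup; split.
  by move=> /mapP[y yB ->]; exists y.
by move=> [y yB ->]; apply/mapP; exists y.
Qed.

Lemma vals_sorted : sorted <%R vals.
Proof. by rewrite sort_lt_sorted undup_uniq. Qed.

Lemma vals_uniq : uniq vals.
Proof. by rewrite sort_uniq undup_uniq. Qed.

Lemma vals_path x : x \in vals -> exists j, btw p j va /\ key j = x.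
Proof.
move=> /mem_vals[y yB ->]; have [j [h1 h2 h3]] := path_projection (f y).
by exists j; split=> //; rewrite basic_da // basic_dr // (projection_key h2).
Qed.

(** A latent vertex of the path has a branch off the path, and a regular vertex in
    this branch has the right value of D.  Without this, the skeleton would jump
    over vertices of the tree. *)
Lemma path_vals j : btw p j va -> key j \in vals.
Proof.
move=> h; apply/mem_vals.
have [->|jp] := eqVneq j p.
  exists rho => //; rewrite basic_da // basic_dr //.
have jK := path_in_region h jp.
have [jW|jW] := boolP (j \in W).
  have jB := @bag_reg _ _ _ _ _ _ _ _ gB (exist _ j jW) jK.
  exists (inl (exist _ j jW)) => //.
  by rewrite basic_da // basic_dr // !lab.
have [w wW [h1 h2]] := regular_third_branch dm low_degree p va jW.
have wK : w \in K.
  apply: (bag_closed gB jK); apply/negP => h'.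
  rewrite (btw_sym dm) in h'; rewrite (btw_sym dm) in h1; move: jp.
  by rewrite (btw_anti dm h1 h') eqxx.
have wB := @bag_reg _ _ _ _ _ _ _ _ gB (exist _ w wW) wK.
exists (inl (exist _ w wW)) => //.
by rewrite basic_da // basic_dr // !lab (projection_key h1).
Qed.

Definition path_vertex (x : R) : V :=
  if [pick j | btw p j va && (key j == x)] is Some j then j else p.
Let vert := path_vertex.

Lemma path_vertexP x : x \in vals -> btw p (vert x) va /\ key (vert x) = x.
Proof.
move=> /vals_path[j [h1 h2]]; rewrite /vert /path_vertex.
by case: pickP => [j' /andP[? /eqP]|/(_ j)] //; rewrite h1 h2 eqxx.
Qed.

Lemma path_vertex_key j : btw p j va -> vert (key j) = j.
Proof.
move=> h; have [h1 h2] := path_vertexP (path_vals h).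
exact: path_key_inj h1 h h2.
Qed.

Let A x := [fset v in bset B | da v - dr v == x].
Let u x := choice [fset v in A x | all (fun w => da v <= da w) (enum_fset (A x))].
Let on_path x := dr (u x) + da (u x) == da (brep B).

Lemma mem_A x y : x \in vals -> y \in A x <->
  [/\ y \in bset B, btw p (vert x) (f y) & btw va (vert x) (f y)].
Proof.
move=> xv; have [h1 h2] := path_vertexP xv.
rewrite !inE /=; split=> [/andP[yB /eqP D]|[yB h3 h4]].
  have [j [k1 k2 k3]] := path_projection (f y).
  have -> : vert x = j; last by split.
  apply: path_key_inj h1 k1 _.
  by rewrite h2 -(projection_key k2 k3) -D basic_da // basic_dr.
by rewrite yB basic_da // basic_dr // (projection_key h3 h4) h2 eqxx.
Qed.

Lemma mem_u x : x \in vals -> u x \in A x /\ forall y, y \in A x -> da (u x) <= da y.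
Proof.
move=> xv; have [y yB xy] := (mem_vals x).1 xv.
have yA : y \in enum_fset (A x) by rewrite !inE /= yB xy eqxx.
have : u x \in [fset v in A x | all (fun w => da v <= da w) (enum_fset (A x))].
  apply: choice_in; apply/fset0Pn.
  have [z zA zmin] : exists2 z, z \in enum_fset (A x) &
      forall t, t \in enum_fset (A x) -> da z <= da t.
    elim: (enum_fset (A x)) (y) yA => // z s IH y' _.
    case: s IH => [_|t s IH].
      by exists z; rewrite ?inE // => t; rewrite inE => /eqP->.
    have [w ws wmin] := IH t (mem_head _ _).
    case: (leP (da z) (da w)) => h.
      exists z; rewrite ?inE ?eqxx // => t'; rewrite inE => /orP[/eqP->//|/wmin].
      exact: le_trans.
    exists w; rewrite 1?inE ?ws ?orbT // => t'; rewrite inE.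
    by move=> /orP[/eqP->|/wmin//]; exact: ltW.
  exists z; rewrite !inE /=; move: (zA); rewrite !inE /= => ->.
  by apply/allP => t /zmin.
rewrite inE /= => /andP[h /allP hm]; split=> //; exact: hm.
Qed.

(** The equality tested by the algorithm says that the node nearest to the pivot is
    on the path, and then it is the vertex at which its bag hangs. *)
Lemma on_pathE x : x \in vals -> on_path x = (f (u x) == vert x).
Proof.
move=> xv; have [/(mem_A _ xv)[uB h1 h2] _] := mem_u xv.
have [h3 _] := path_vertexP xv.
rewrite /on_path basic_da // basic_dr // basic_da // -/rho -/p.
apply/idP/eqP => [h|->]; last first.
  by rewrite (tm_sym dm (vert x) p).
rewrite (tm_sym dm (f (u x)) p) in h.
apply: (btw_inj dm h h3).
move/eqP: h => h; move/eqP: h1 => h1; move/eqP: h2 => h2; move/eqP: h3 => h3.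
rewrite (tm_sym dm va (f (u x))) (tm_sym dm va) in h2.
have := tm_ge0 dm (vert x) (f (u x)); lra.
Qed.

(** If the vertex at which the bag hangs is itself in the bag, it is the strict
    minimizer of the distance to the pivot. *)
Lemma on_path_node x y : x \in vals -> y \in A x -> f y = vert x ->
  on_path x /\ u x = y.
Proof.
move=> xv yA fy; have [uA umin] := mem_u xv.
have [yB _ _] := (mem_A y xv).1 yA; have [uB h1 h2] := (mem_A _ xv).1 uA.
have fu : f (u x) = vert x.
  have := umin _ yA; rewrite !basic_da // fy => le.
  move/eqP: h2; rewrite (tm_sym dm va) (tm_sym dm va) => h.
  by symmetry; apply: (tm_eq0 dm); have := tm_ge0 dm (vert x) (f (u x)); lra.
split; first by rewrite on_pathE // fu.
by apply: (bag_inj lab gB) => //; rewrite fu.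
Qed.

Lemma basic_bagE x : bg x = if on_path x then Bag (A x) (u x) (bdist B)
  else Bag (inr (c + index x vals)%N |` A x) (inr (c + index x vals)%N)
    (fun v => (da v + dr v - da (brep B)) / 2).
Proof. by []. Qed.

(** The naming extended to the latent nodes introduced by this call. *)
Definition basic_names (y : node L) : V :=
  if y is inr i then
    if (c <= i < c + size vals)%N then vert (nth 0 vals (i - c)) else f y
  else f y.
Let f' := basic_names.

Lemma basic_names_old x : is_regular x \/ (exists2 i, x = inr i & (i < c)%N) ->
  f' x = f x.
Proof. by case=> [|[i -> ic]] /=; [case: x|rewrite leqNgt ic]. Qed.

Lemma basic_names_rho : f' rho = p.
Proof.
apply: basic_names_old; case E: rho => [w|i]; first by left.
by right; exists i => //; apply: (bag_fresh gB).
Qed.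

Lemma basic_names_new x : x \in vals -> f' (inr (c + index x vals)%N) = vert x.
Proof.
move=> xv; rewrite /f' /= leq_addr ltn_add2l index_mem xv /=.
by rewrite addnC addnK nth_index.
Qed.

Lemma basic_names_B x : x \in bset B -> f' x = f x.
Proof.
move=> xB; have [->|xr] := eqVneq x rho; first exact: basic_names_rho.
by apply: basic_names_old; left; have [w ->] := bag_mem gB xB xr.
Qed.

Lemma basic_rep_vertex x : x \in vals -> f' (brep (bg x)) = vert x.
Proof.
move=> xv; rewrite basic_bagE; case: ifP => /= h; last exact: basic_names_new.
have [/(mem_A _ xv)[uB _ _] _] := mem_u xv.
by rewrite basic_names_B //; apply/eqP; rewrite -on_pathE.
Qed.

Definition hanging (j : V) : {set V} :=
  [set v in K | [&& v != j, btw p j v & btw va j v]]%SET.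

Lemma hanging_closed j v w : v \in hanging j -> br j v w ->
  w \in hanging j.
Proof.
rewrite !inE => /and4P[vK vj h1 h2] h3.
have wj : w != j by rewrite (branch_sym dm) in h3; exact: (branch_neq dm h3).
have away z : btw z j v -> btw z j w.
  move=> h; apply: contraT => h'.
  have := branch_trans dm (_ : br j z w) (_ : br j w v).
  by rewrite (branch_sym dm j w) h3 /same_branch h h' => /(_ isT isT).
rewrite wj !away // !andbT.
have [jp|jp] := eqVneq j p; first by rewrite jp in h3; exact: (bag_closed gB vK).
apply: (bag_closed gB vK); apply/negP => h.
by move: h3; rewrite /same_branch (btw_trans dm h) // (btw_sym dm).
Qed.

Lemma on_path_or_new x : x \in vals ->
  (on_path x /\ brep (bg x) = u x) \/
  (~~ on_path x /\ brep (bg x) = inr (c + index x vals)%N).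
Proof. by rewrite basic_bagE; case: on_path; [left|right]. Qed.

Lemma basic_bag_mem x y : y \in bset (bg x) ->
  y \in A x \/ y = inr (c + index x vals)%N /\ ~~ on_path x.
Proof.
rewrite basic_bagE; case: on_path => /= [|]; first by left.
by rewrite in_fset1U => /orP[/eqP|]; [right|left].
Qed.

Lemma basic_bag_sub x y : y \in A x -> y \in bset (bg x).
Proof.
by move=> yA; rewrite basic_bagE; case: on_path => //=; rewrite in_fset1U yA orbT.
Qed.

(** The recorded distance from [v] to a new latent node is right because this node
    is the median of [v], the pivot and the old representative. *)
Lemma represents_basic_bag x : x \in vals ->
  represents d f' (c + size vals) (bg x) (hanging (vert x)).
Proof.
move=> xv; have [hj kj] := path_vertexP xv; have [uA umin] := mem_u xv.
have [uB hu1 hu2] := (mem_A _ xv).1 uA.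
have frep := basic_rep_vertex xv.
(* a node at the vertex where the bag hangs is its representative *)
have off y : y \in A x -> y != brep (bg x) -> f y != vert x.
  move=> yA; apply: contraNneq => fy; have [h uy] := on_path_node xv yA fy.
  by apply/eqP; rewrite basic_bagE h; exact: esym uy.
have memA y : y \in bset (bg x) -> y != brep (bg x) -> y \in A x.
  move=> yb yr; case: (basic_bag_mem yb) => // -[yi non]; move: yr.
  by rewrite basic_bagE (negPf non) /= yi eqxx.
have mem y : y \in bset (bg x) -> y != brep (bg x) ->
    exists2 w : L, y = inl w & val w \in hanging (vert x).
  move=> yb yr; have yA := memA _ yb yr.
  have [yB h1 h2] := (mem_A _ xv).1 yA; have fy := off _ yA yr.
  have [yrho|yrho] := eqVneq y rho.
    case/eqP: fy; rewrite yrho; symmetry; apply: (btw_same dm).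
    by move: h1; rewrite yrho.
  have [w yw wK] := bag_mem gB yB yrho; exists w => //.
  by rewrite inE wK; move: fy h1 h2; rewrite yw lab => -> -> ->.
split.
- rewrite basic_bagE; case: on_path => //=; by rewrite in_fset1U eqxx.
- move=> i; case: (on_path_or_new xv) => [[_ ->] ui|[_ ->] [<-]]; last first.
    by rewrite ltn_add2l index_mem.
  apply: leq_trans (leq_addr _ _); apply: (bag_fresh gB).
  have [//|ur] := eqVneq (u x) (brep B); first by rewrite ui.
  by have [w uw _] := bag_mem gB uB ur; move: (esym ui); rewrite uw.
- by rewrite frep inE eqxx andbF.
- by move=> v w; rewrite frep; apply: hanging_closed.
- exact: mem.
- move=> w; rewrite inE => /and4P[wK wj h1 h2]; apply: basic_bag_sub.
  by apply/(mem_A _ xv); rewrite lab; split=> //; exact: (bag_reg gB).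
move=> y yb yr; rewrite frep; have [w yw _] := mem y yb yr.
have yA := memA _ yb yr; have [yB h1 h2] := (mem_A _ xv).1 yA.
rewrite basic_names_B // basic_bagE; case: ifP => /= h.
  case: (on_path_or_new xv) => [[_ ru]|[]]; last by rewrite h.
  move=> nreg; have urho : u x = rho.
    apply/eqP; apply: contraT => ur.
    by have [w' uw] := bag_mem gB uB ur; rewrite uw in nreg.
  rewrite (bag_dist gB) // -/rho -/p.
  - congr (d _ _); have := on_pathE xv; rewrite h urho => /esym/eqP <-.
    by [].
  - by rewrite -urho -ru.
  - by rewrite -/rho -urho.
move=> _; rewrite !basic_da ?basic_dr // -/rho -/p.
move/eqP: h1 => h1; move/eqP: h2 => h2; move/eqP: hj => hj.
rewrite (tm_sym dm (f y) va) (tm_sym dm (f y) p) -h1 -h2 -hj.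
rewrite (tm_sym dm va (vert x)) (tm_sym dm (f y) (vert x)); lra.
Qed.

Lemma basic_region x : x \in vals -> region d f' (bg x) = hanging (vert x).
Proof.
move=> xv; have lab' : labels f' by move=> w; rewrite basic_names_old ?lab //; left.
exact: (bag_region dm low_degree lab' (represents_basic_bag xv)).
Qed.

Let bags := map bg vals.

Lemma hanging_vals v x : x \in vals -> v \in hanging (vert x) ->
  x = d v va - d v p.
Proof.
move=> xv; rewrite inE => /and4P[_ _ h1 h2].
by rewrite (projection_key h1 h2); have [_ ->] := path_vertexP xv.
Qed.

Lemma overlap_basicE v :
  overlap d f' bags v = count (fun x => v \in hanging (vert x)) vals.
Proof.
rewrite /overlap count_map; apply: eq_in_count => x xv /=.
by rewrite basic_region.
Qed.

(** The region of a vertex determines its value of D, and the values are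
    distinct. *)
Lemma overlap_basic_le v : (overlap d f' bags v <= (v \in K))%N.
Proof.
rewrite overlap_basicE; case vK: (v \in K); last first.
  rewrite leqn0 -leqn0 leqNgt -has_count; apply/hasP => -[x _].
  by rewrite inE vK.
apply: (@leq_trans (count (pred1 (d v va - d v p)) vals)).
  elim: vals (fun x (h : x \in vals) => @hanging_vals v x h) => //= x s IH H.
  apply: leq_add; last by apply: IH => y ys; apply: H; rewrite inE ys orbT.
  case: (boolP (v \in _)) => // h.
  by rewrite -(H x (mem_head _ _) h) eqxx.
by rewrite (count_uniq_mem _ vals_uniq); case: (_ \in vals).
Qed.

Lemma overlap_basic_path j : btw p j va -> overlap d f' bags j = 0%N.
Proof.
move=> h; rewrite overlap_basicE; apply/eqP; rewrite -leqn0 leqNgt -has_count.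
apply/hasP => -[x xv]; rewrite inE => /and4P[_ jx h1 h2].
have [hx _] := path_vertexP xv.
move/eqP: jx; apply; apply: (path_key_inj h hx).
by rewrite -(projection_key h1 h2).
Qed.

Lemma overlap_basic_ge v : v \in K -> ~~ btw p v va -> (0 < overlap d f' bags v)%N.
Proof.
move=> vK nv; rewrite overlap_basicE -has_count.
have [j [h1 h2 h3]] := path_projection v.
apply/hasP; exists (key j); first exact: path_vals.
rewrite path_vertex_key // inE vK h2 h3 !andbT /=.
by apply: contraNneq nv => ->.
Qed.

(** A vertex between two consecutive path vertices would lie on the path, and its
    coordinate would be a value between two consecutive ones. *)
Lemma basic_skeleton_edge x y : (x, y) \in zip vals (behead vals) ->
  e (vert x) (vert y).
Proof.
move/(mem_zip_behead _ _ vals_sorted) => [xv yv xy H].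
have [hx kx] := path_vertexP xv; have [hy ky] := path_vertexP yv.
apply/(tm_edge dm); split.
  by apply: contraTneq xy => exy; rewrite -kx -ky exy ltxx.
move=> z hz.
have le : d p (vert y) <= d p (vert x).
  move/eqP: hx => hx; move/eqP: hy => hy; move: kx ky; rewrite /key /path_key.
  by rewrite (tm_sym dm (vert x) p) (tm_sym dm (vert y) p); lra.
have hyx : btw p (vert y) (vert x) := tm_linear dm hy hx le.
have hz' : btw p z (vert x).
  by apply: (btw_transr dm hyx); rewrite (btw_sym dm).
have zp : btw p z va by exact: (btw_trans dm hx).
have := H _ (path_vals zp); rewrite negb_and -!leNgt.
have hyz : btw p (vert y) z.
  apply: (tm_linear dm hyx hz' _).
  move/eqP: hz => hz; move/eqP: hyx => hyx; move/eqP: hz' => hz'.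
  have := tm_sym dm (vert x) z; have := tm_sym dm (vert x) (vert y).
  have := tm_sym dm z (vert y); have := tm_ge0 dm (vert y) z; lra.
move=> /orP[] le'; [left|right].
  rewrite -kx /key /path_key (tm_sym dm z p) (tm_sym dm (vert x) p) in le'.
  apply: (btw_inj dm zp hx).
  move/eqP: hx => hx; move/eqP: zp => zp; move/eqP: hz' => hz'.
  have := tm_ge0 dm z (vert x); lra.
rewrite -ky /key /path_key (tm_sym dm z p) (tm_sym dm (vert y) p) in le'.
apply: (btw_inj dm zp hy).
move/eqP: hy => hy; move/eqP: zp => zp; move/eqP: hyz => hyz.
have := tm_ge0 dm (vert y) z; lra.
Qed.

(** Conversely, a value between the coordinates of the ends of an edge would belong
    to a path vertex inside the edge. *)
Lemma path_edge_skeleton v w : btw p v va -> btw p w va -> e v w ->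
  exists x y, (x, y) \in zip vals (behead vals) /\
    ((vert x, vert y) = (v, w) \/ (vert x, vert y) = (w, v)).
Proof.
suff main v' w' : btw p v' va -> btw p w' va -> e v' w' -> key v' < key w' ->
    exists x y, (x, y) \in zip vals (behead vals) /\ (vert x, vert y) = (v', w').
  move=> hv hw ev; case: (ltgtP (key v) (key w)) => h.
  - by have [x [y [? ?]]] := main _ _ hv hw ev h; exists x, y; split=> //; left.
  - have ew : e w v by apply/(tm_edge dm); case/(tm_edge dm): ev => n H;
      split; [by rewrite eq_sym|move=> z; rewrite (btw_sym dm) => /H[]; tauto].
    by have [x [y [? ?]]] := main _ _ hw hv ew h; exists x, y; split=> //; right.
  - by have := edge_neq dm ev; rewrite (path_key_inj hv hw h) eqxx.
move=> hv hw ev lt; exists (key v'), (key w').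
rewrite !path_vertex_key //; split=> //; apply/(mem_zip_behead _ _ vals_sorted).
split=> //; try exact: path_vals.
move=> x xv; apply/negP => /andP[lt1 lt2].
have [hx kx] := path_vertexP xv; move: lt1 lt2; rewrite -kx => lt1 lt2.
have dE j : btw p j va -> key j = d p va - 2 * d p j.
  move=> /eqP h; rewrite /key /path_key (tm_sym dm j p); lra.
rewrite !dE // in lt1 lt2.
have b1 : btw p w' (vert x) by apply: (tm_linear dm hw hx); lra.
have b2 : btw p (vert x) v' by apply: (tm_linear dm hx hv); lra.
have b3 : btw w' (vert x) v' by apply: (btw_transl dm b2).
rewrite (btw_sym dm) in b3.
case/(tm_edge dm): ev => _ /(_ _ b3)[ex|ex]; rewrite ex in lt1 lt2; lra.
Qed.

Let E' := [seq (brep (bg ab.1), brep (bg ab.2)) | ab <- zip vals (behead vals)].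

Lemma mem_skeleton y z : (y, z) \in E' -> exists x1 x2,
  [/\ (x1, x2) \in zip vals (behead vals), y = brep (bg x1) & z = brep (bg x2)].
Proof. by move=> /mapP[[x1 x2] h [-> ->]]; exists x1, x2. Qed.

Lemma nodes_basic E rest y : y \in nodes (E ++ E') (bags ++ rest) ->
  y \in nodes E (B :: rest) \/ exists2 x, x \in vals & y = brep (bg x).
Proof.
have valsP x1 x2 : (x1, x2) \in zip vals (behead vals) ->
    x1 \in vals /\ x2 \in vals.
  by move/(mem_zip_behead _ _ vals_sorted) => [].
rewrite /nodes /unzip1 /unzip2 !map_cat !mem_cat /= inE.
case/orP=> [/orP[->|]|/orP[/orP[->|]|/orP[|->]]]; rewrite ?orbT;
  try by left.
- move=> /mapP[[y' z] /mem_skeleton[x1 [x2 [/valsP[h _] -> _]]] ->].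
  by right; exists x1.
- move=> /mapP[[y' z] /mem_skeleton[x1 [x2 [/valsP[_ h] _ ->]]] ->].
  by right; exists x2.
- by rewrite -map_comp => /mapP[x xv ->]; right; exists x.
Qed.

Lemma region_basic_rest rest E : recovery e d f (B :: rest) E c ->
  every (fun C => region d f' C = region d f C) rest.
Proof.
move=> rec.
have : every (fun C => brep C \in nodes E (B :: rest)) rest.
  have sub C : C \in map (@brep R L) rest -> C \in nodes E (B :: rest).
    by move=> h; rewrite /nodes !mem_cat /= inE h !orbT.
  move: (nodes _ _) sub => N; elim: (rest) => // C s IH h.
  apply/every_cons; split; first by apply: h; rewrite /= inE eqxx.
  by apply: IH => C' hC; apply: h; rewrite /= inE hC orbT.
apply: every_imp => C h; apply: region_ext; apply: basic_names_old.
case: (brep C) h => [w|i] h; first by left.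
by right; exists i => //; apply: (recovery_fresh rec).
Qed.

(** The vertices of the path leave the region of the bag and become
    representatives, and the edges between them become output.  An edge that
    touched the region and touches none of the new regions has both ends on the
    path, as the region can only be left through [p]. *)
Lemma recovery_basic rest E : recovery e d f (B :: rest) E c ->
  recovery e d f' (bags ++ rest) (E ++ E') (c + size vals).
Proof.
move=> rec.
have KE : region d f B = K := bag_region dm low_degree lab gB.
have rhoN : rho \in nodes E (B :: rest).
  by rewrite /nodes !mem_cat /= inE eqxx !orbT.
have oldE y : y \in nodes E (B :: rest) -> f' y = f y.
  move=> yN; apply: basic_names_old; case: y yN => [w|i] yN; first by left.
  by right; exists i => //; apply: (recovery_fresh rec).
have covB v : overlap d f (B :: rest) v = ((v \in K) + overlap d f rest v)%N.
  by rewrite /overlap /= KE.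
have brepN C : C \in map (@brep R L) rest -> C \in nodes E (B :: rest).
  by move=> h; rewrite /nodes !mem_cat /= inE h !orbT.
have rest_ok : every (fun C => represents d f' (c + size vals) C (region d f' C) /\
    region d f' C = region d f C) rest.
  have h1 := region_basic_rest rec.
  have := recovery_bags rec; move=> /every_cons[_ h2].
  have : every (fun C => brep C \in nodes E (B :: rest)) rest.
    move: (nodes _ _) brepN => N; elim: (rest) => // C s IH h.
    apply/every_cons; split; first by apply: h; rewrite /= inE eqxx.
    by apply: IH => C' hC; apply: h; rewrite /= inE hC orbT.
  move=> h3; have := every_and h1 (every_and h2 h3).
  apply: every_imp => C [rE [h4 h5]].
  split=> //; rewrite rE; apply: bag_ext h4; last exact: leq_addr.
  move=> y [hy|->]; last exact: oldE.
  by apply: basic_names_old; left.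
have covrest v : overlap d f' rest v = overlap d f rest v.
  elim: (rest) rest_ok => // C s IH /every_cons[[_ h] /IH].
  by rewrite /overlap /= h => ->.
have covE v : overlap d f' (bags ++ rest) v = (overlap d f' bags v + overlap d f rest v)%N.
  by rewrite -covrest /overlap count_cat.
have avoid := recovery_avoid rec; have disj := recovery_disjoint rec.
have repK x : x \in vals -> vert x != p -> vert x \in K.
  by move=> xv; apply: path_in_region; have [] := path_vertexP xv.
have rep_rho x : x \in vals -> vert x = p -> brep (bg x) = rho.
  move=> xv vx; have rA : rho \in A x.
    apply/(mem_A _ xv); split=> //; rewrite -/p vx ?btw_left ?btw_right //.
      exact: (btw_left dm).
    exact: (btw_right dm).
  have [h1 h2] := on_path_node xv rA (esym vx).
  by rewrite basic_bagE h1.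
split.
- by move=> w; rewrite basic_names_old ?lab //; left.
- apply/every_cat; split; last by apply: every_imp rest_ok => C [].
  apply: every_map => x xv; rewrite basic_region //; exact: represents_basic_bag.
- move=> v; rewrite covE; apply: leq_trans (disj v); rewrite covB leq_add2r.
  exact: overlap_basic_le.
- have mixed y x : y \in nodes E (B :: rest) -> x \in vals ->
      f' y = vert x -> y = brep (bg x).
    move=> yN xv; rewrite oldE // => fy; have [vx|vx] := eqVneq (vert x) p.
      by rewrite rep_rho //; apply: (recovery_inj rec) => //; rewrite fy vx.
    by have := avoid _ yN; rewrite fy covB repK.
  move=> y z /nodes_basic[yN|[x xv ->]] /nodes_basic[zN|[x' xv' ->]].
  + by rewrite !oldE //; apply: (recovery_inj rec).
  + by rewrite (basic_rep_vertex xv'); exact: mixed.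
  + by rewrite (basic_rep_vertex xv) => h; symmetry; apply: mixed.
  rewrite !basic_rep_vertex // => vv.
  have [_ <-] := path_vertexP xv; have [_ <-] := path_vertexP xv'.
  by rewrite vv.
- move=> y /nodes_basic[yN|[x xv ->]]; rewrite covE.
    rewrite oldE //; have := avoid _ yN; rewrite covB => /eqP.
    rewrite addn_eq0 => /andP[/eqP h /eqP ->]; rewrite addn0; apply/eqP.
    by rewrite -leqn0 -h overlap_basic_le.
  rewrite basic_rep_vertex //; have [hx _] := path_vertexP xv.
  rewrite overlap_basic_path // add0n.
  have [vx|vx] := eqVneq (vert x) p.
    by rewrite vx; have := avoid _ rhoN; rewrite covB => /eqP;
       rewrite addn_eq0 => /andP[_ /eqP].
  have := disj (vert x); rewrite covB repK // add1n ltnS leqn0.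
  by move/eqP.
- move=> i /nodes_basic[iN|[x xv irep]].
    by apply: leq_trans (leq_addr _ _); apply: (recovery_fresh rec).
  by apply: (bag_fresh (represents_basic_bag xv)); rewrite -irep.
- move=> [y z]; rewrite mem_cat => /orP[aE|].
    have yN : y \in nodes E (B :: rest).
      by rewrite /nodes !mem_cat; apply/orP; left; apply/mapP; exists (y, z).
    have zN : z \in nodes E (B :: rest).
      rewrite /nodes !mem_cat; apply/orP; right; apply/orP; left.
      by apply/mapP; exists (y, z).
    by rewrite /= !oldE //; exact: (recovery_edge rec aE).
  move=> /mem_skeleton[x1 [x2 [h -> ->]]] /=.
  have [xv1 xv2 _ _] := (mem_zip_behead _ _ vals_sorted).1 h.
  by rewrite !basic_rep_vertex //; exact: basic_skeleton_edge.
move=> v w evw; case: (recovery_cover rec evw) => [[[y z] aE h]|].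
  left; exists (y, z); first by rewrite mem_cat aE.
  have yN : y \in nodes E (B :: rest).
    by rewrite /nodes !mem_cat; apply/orP; left; apply/mapP; exists (y, z).
  have zN : z \in nodes E (B :: rest).
    rewrite /nodes !mem_cat; apply/orP; right; apply/orP; left.
    by apply/mapP; exists (y, z).
  by rewrite /= !oldE.
have [h|] := boolP (0 < overlap d f' (bags ++ rest) v + overlap d f' (bags ++ rest) w)%N.
  by right.
rewrite -leqNgt leqn0 addn_eq0 !covE !addn_eq0.
move=> /andP[/andP[cv rv] /andP[cw rw]].
rewrite !covB (eqP rv) (eqP rw) !addn0 => h; left.
have inpath t : t \in K -> overlap d f' bags t == 0%N -> btw p t va.
  move=> tK; apply: contraTT => nt; rewrite -lt0n; exact: overlap_basic_ge.
have other s t : e s t -> s \in K -> overlap d f' bags t == 0%N -> btw p t va.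
  move=> est sK ct; have [->|tp] := eqVneq t p; first exact: (btw_left dm).
  apply: inpath => //; apply: (bag_closed gB sK); apply/negP => hst.
  case/(tm_edge dm): est => _ /(_ _ hst)[ps|pt].
    by have := bag_notin gB; rewrite ps sK.
  by rewrite -/rho -/p in pt; rewrite pt eqxx in tp.
have [hv hw] : btw p v va /\ btw p w va.
  case vK: (v \in K) h => /=.
    by move=> _; split; [exact: inpath|exact: (other v w)].
  rewrite add0n lt0b => wK; split; last exact: inpath.
  apply: (other w v) => //; apply/(tm_edge dm); case/(tm_edge dm): evw => n H.
  by split; [rewrite eq_sym|move=> t; rewrite (btw_sym dm) => /H[]; tauto].
have [x [y [xy hxy]]] := path_edge_skeleton hv hw evw.
have [xv yv _ _] := (mem_zip_behead _ _ vals_sorted).1 xy.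
exists (brep (bg x), brep (bg y)).
  rewrite mem_cat; apply/orP; right; apply/mapP; exists (x, y) => //.
by rewrite /= !basic_rep_vertex.
Qed.

Lemma basic_bags_inside : every (fun C =>
  [/\ region d f' C \subset K, (forall w, inl w \in bset C -> inl w \in bset B)
   & va \notin region d f' C]) bags.
Proof.
apply: every_map => x xv; rewrite basic_region //; split.
- by apply/fintype.subsetP => v; rewrite inE => /andP[].
- move=> w /basic_bag_mem[/(mem_A _ xv)[]//|[]] //.
rewrite inE; apply/negP => /and4P[_ vx h1 h2].
by move: vx; rewrite (btw_same dm h2) eqxx.
Qed.
End BasicGeometry.

(** * Splitting along a sequence of pivots *)

Section Recovery.
Variables (R : realType) (V : finType) (e : rel V) (W : {set V}).
Variables (d : V -> V -> R).
Hypothesis dm : tree_metric e d.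
Hypothesis low_degree : forall v, (degree e v <= 2)%N -> v \in W.
Local Notation L := {v : V | v \in W}.
Local Notation btw := (between d).
Local Notation br := (same_branch d).
Variable choice : {fset node L} -> node L.
Hypothesis choice_in : forall A, A != fset0 -> choice A \in A.
Local Notation recovery := (recovery e d).

Lemma recovery_perm f (bs bs' : seq (bag R L)) E c :
  (forall P, count P bs = count P bs') ->
  recovery f bs E c -> recovery f bs' E c.
Proof.
move=> cnt rec.
have nodesE x : x \in nodes E bs' -> x \in nodes E bs.
  rewrite /nodes !mem_cat; case/orP=> [->//|/orP[->|]]; rewrite ?orbT //.
  have memE (s : seq (bag R L)) : (x \in map (@brep R L) s) = has (fun B => brep B == x) s.
    by elim: s => //= B s IH; rewrite inE IH eq_sym.
  by rewrite !memE !has_count cnt => ->; rewrite !orbT.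
have covE v : overlap d f bs' v = overlap d f bs v by rewrite /overlap cnt.
case: rec => h1 h2 h3 h4 h5 h6 h7 h8; split=> //.
- move: h2; rewrite /every !all_count -!count_predT => /eqP h2.
  by rewrite -!cnt h2.
- by move=> v; rewrite covE.
- by move=> x y /nodesE xN /nodesE yN; exact: h4.
- by move=> x /nodesE; rewrite covE; exact: h5.
- by move=> i /nodesE; exact: h6.
- by move=> x y /h8; rewrite !covE.
Qed.

Lemma recovery_le f (bs : seq (bag R L)) E c c' : (c <= c')%N ->
  recovery f bs E c -> recovery f bs E c'.
Proof.
move=> cc [h1 h2 h3 h4 h5 h6 h7 h8]; split=> //.
  by apply: every_imp h2 => B; apply: bag_ext.
by move=> i /h6 /leq_trans; apply.
Qed.

(** The bags of an intermediate collection stay in the part [K] of the tree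
    and among the nodes [M], and the nodes [S] are no longer to be placed. *)
Definition inside f (K : {set V}) (M : {fset node L}) (S : seq (node L))
    (C : bag R L) :=
  [/\ region d f C \subset K, (forall w, inl w \in bset C -> inl w \in M) &
     forall w : L, inl w \in S -> val w \notin region d f C].

Lemma every_overlap0 f (bs : seq (bag R L)) v : overlap d f bs v = 0%N ->
  every (fun C => v \notin region d f C) bs.
Proof.
rewrite /overlap; elim: bs => // B s IH /= /eqP; rewrite addn_eq0.
move=> /andP[h /eqP/IH hs]; apply/every_cons; split=> //.
by case: (_ \in _) h.
Qed.

Lemma count_filter_cat T (a P : pred T) s :
  count P s = count P ([seq x <- s | a x] ++ [seq x <- s | ~~ a x]).
Proof.
elim: s => //= x s IH; case: (a x) => /=; rewrite IH !count_cat //= addnCA //.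
Qed.

Lemma overlap_cat f (s t : seq (bag R L)) v :
  overlap d f (s ++ t) v = (overlap d f s v + overlap d f t v)%N.
Proof. exact: count_cat. Qed.

(** A node which is not the representative of its bag lies in a region, and regions
    are disjoint and contain no representative. *)
Lemma filter_bag f (bs Q : seq (bag R L)) E c u B s :
  recovery f (bs ++ Q) E c -> [seq B <- bs | u \in bset B] = B :: s ->
  u != brep B -> s = [::].
Proof.
move=> rec fE ur; case: s fE => // B' s fE.
have : every (fun C => represents d f c C (region d f C)) bs.
  by have /every_cat[] := recovery_bags rec.
move=> /every_filter - /(_ (fun B => u \in bset B)); rewrite fE.
move=> /every_cons[gB /every_cons[gB' _]].
have := filter_all (fun B => u \in bset B) bs; rewrite fE => /and3P[uB uB' _].
have [w uw wK] := bag_mem gB uB ur.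
have cB P : (count P (B :: B' :: s) <= count P (bs ++ Q))%N.
  rewrite -fE count_cat (count_filter_cat (fun B => u \in bset B) P bs) count_cat.
  by rewrite -addnA leq_addr.
have lab := recovery_labels rec.
have [ur'|ur'] := eqVneq u (brep B').
  have uN : u \in nodes E (bs ++ Q).
    rewrite /nodes !mem_cat; apply/orP; right; apply/orP; right.
    have : has (fun B => brep B == u) (bs ++ Q).
      rewrite has_count; apply: leq_trans (cB _).
      by rewrite /= -ur' eqxx; case: (_ == _).
    by elim: (bs ++ Q) => //= C r IH /orP[/eqP->|/IH h]; rewrite inE ?eqxx ?h ?orbT.
  have := recovery_avoid rec uN; have := cB (fun B => f u \in region d f B).
  by rewrite /overlap /= uw lab wK => h1 h2; rewrite h2 in h1.
have [w' uw' wK'] := bag_mem gB' uB' ur'.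
have := leq_trans (cB (fun B => val w \in region d f B)) (recovery_disjoint rec _).
by rewrite /= wK; move: uw'; rewrite uw => -[->]; rewrite wK'.
Qed.

Lemma cost_basic_le dd f K M S (B : bag R L) alpha c : inside f K M S B ->
  (cost dd (basic choice B alpha c) <= 2 * #|` M|)%N.
Proof.
move=> [_ BM _]; apply: leq_trans (cost_basic _ _ _ _ _) _.
rewrite leq_pmul2l // -size_filter; apply: uniq_leq_size.
  by rewrite filter_uniq // fset_uniq.
by move=> x; rewrite mem_filter => /andP[]; case: x => // w _ /BM.
Qed.

(** A pivot ends up outside of all the regions: it is a discovered node, or becomes
    one.  The bound on the queries is crude: each pivot may query every node
    twice, for its distances to the pivot and to the representative. *)
Lemma splits_recovery dd (Q : seq (bag R L)) E0 K M us : forall f bs E c S,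
  (forall a b : L, inl a \in M -> inl b \in M -> dd a b = d (val a) (val b)) ->
  recovery f (bs ++ Q) (E0 ++ E) c -> every (inside f K M S) bs ->
  exists f' bs' E' c',
  [/\ result dd (splits choice bs E c us) = (bs', E', c'),
      recovery f' (bs' ++ Q) (E0 ++ E') c', (c <= c')%N,
      every (inside f' K M (S ++ us)) bs' &
      (cost dd (splits choice bs E c us) <= size us * (2 * #|` M|))%N].
Proof.
elim: us => [|u us IH] f bs E c S ag rec ins.
  by exists f, bs, E, c; split=> //; rewrite cats0.
rewrite [size _]/= [splits _ _ _ _ _]/=.
have goods : every (fun C => represents d f c C (region d f C)) bs.
  by have /every_cat[] := recovery_bags rec.
have lab := recovery_labels rec.
(* pivots that are already representatives, or in no bag at all *)
have skip : every (fun C => forall w, u = inl w -> val w \notin region d f C) bs ->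
    exists f' bs' E' c',
    [/\ result dd (splits choice bs E c us) = (bs', E', c'),
      recovery f' (bs' ++ Q) (E0 ++ E') c', (c <= c')%N,
      every (inside f' K M (S ++ u :: us)) bs' &
      (cost dd (splits choice bs E c us) <= (size us).+1 * (2 * #|` M|))%N].
  move=> hu; have : every (inside f K M (S ++ [:: u])) bs.
    apply: every_imp (every_and ins hu) => C [[h1 h2 h3] h4]; split=> // w.
    by rewrite mem_cat inE => /orP[/h3//|/eqP uw]; apply: h4.
  case/(IH _ _ _ _ _ ag rec) => f' [bs' [E' [c' [h1 h2 h3 h4 h5]]]].
  exists f', bs', E', c'; split=> //; first by rewrite -cat1s catA.
  by rewrite mulSn; apply: leq_trans h5 (leq_addl _ _).
have notin C : represents d f c C (region d f C) -> u \notin bset C ->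
    forall w, u = inl w -> val w \notin region d f C.
  by move=> gC uC w uw; apply: contra uC => h; rewrite uw (bag_reg gC).
case fE: [seq B <- bs | u \in bset B] => [|B s].
  apply: skip; have /eqP : size [seq B <- bs | u \in bset B] = 0%N by rewrite fE.
  rewrite size_filter -leqn0 leqNgt -has_count -all_predC => h.
  by apply: every_imp (every_and goods (_ : every (fun C => u \notin bset C) bs)) => 
    [C [h1 h2]|]; [exact: notin|apply: sub_all h => C hC; apply/asboolP].
case: ifP => [/eqP ur|/negbT ur].
  apply: skip; have uN : u \in nodes (E0 ++ E) (bs ++ Q).
    rewrite /nodes !mem_cat; apply/orP; right; apply/orP; right.
    rewrite map_cat mem_cat; apply/orP; left.
    have : has (fun B => u == brep B) [seq B <- bs | u \in bset B].
      by rewrite fE /= ur eqxx.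
    elim: (bs) => //= C r IHr; rewrite inE; case: ifP => _ /=.
      by move=> /orP[->//|/IHr ->]; rewrite orbT.
    by move=> /IHr ->; rewrite orbT.
  have := recovery_avoid rec uN; rewrite overlap_cat => /eqP.
  rewrite addn_eq0 => /andP[/eqP/every_overlap0 h _].
  by apply: every_imp h => C h w uw; rewrite -lab -uw.
have sE := filter_bag rec fE ur; subst s.
set rest := [seq B <- bs | u \notin bset B].
have rec1 : recovery f (B :: (rest ++ Q)) (E0 ++ E) c.
  apply: recovery_perm rec => P; rewrite -cat_cons -cat1s -fE !count_cat.
  by rewrite (count_filter_cat (fun B => u \in bset B)) count_cat.
have gB : represents d f c B (region d f B).
  by have /every_cons[] := recovery_bags rec1.
have insB : inside f K M S B.
  have := every_filter (fun B => u \in bset B) ins.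
  by rewrite fE => /every_cons[].
have uB : u \in bset B.
  by have := filter_all (fun B => u \in bset B) bs; rewrite fE => /andP[].
have [w uw wK] := bag_mem gB uB ur; subst u.
have agB : agree d dd B by case: insB => _ h _ a b /h aM /h bM; apply: ag.
have rec2 := recovery_basic dm low_degree choice_in lab gB agB uB ur rec1.
have insb := basic_bags_inside dm low_degree choice_in lab gB agB uB.
have regr := region_basic_rest dd w rec1.
rewrite result_bind cost_bind basicE.
move: rec2 insb regr; set f1 := basic_names _ _ _ _ _ _; set bags := map _ _.
set E1 := [seq _ | _ <- _]; set c1 := (c + _)%N => rec2 insb regr.
rewrite -catA catA in rec2.
have ins2 : every (inside f1 K M (S ++ [:: inl w])) (bags ++ rest).
  have [b1 b2 b3] := insB; apply/every_cat; split.
    apply: every_imp insb => C [k1 k2 k3]; split.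
    + exact: fintype.subset_trans k1 b1.
    + by move=> w' /k2 /b2.
    move=> w'; rewrite mem_cat inE => /orP[/b3 hw|/eqP uw]; last by case: uw => ->.
    by apply: contra hw => /(fintype.subsetP k1).
  move/every_cat: regr => [regr _].
  have r1 : every (fun C => inl w \notin bset C) rest.
    apply: sub_all (filter_all (fun B => inl w \notin bset B) bs) => C hC.
    by apply/asboolP.
  have := every_and r1 (every_and regr (every_and (every_filter _ ins) (every_filter _ goods))).
  apply: every_imp => C [k1 [k2 [[k3 k4 k5] k6]]]; split; rewrite ?k2 //.
  move=> w'; rewrite mem_cat inE => /orP[/k5//|/eqP uw].
  exact: notin k6 k1 _ (esym uw).
have [f' [bs' [E' [c' [h1 h2 h3 h4 h5]]]]] := IH _ _ _ _ _ ag rec2 ins2.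
exists f', bs', E', c'; split=> //.
- exact: leq_trans (leq_addr _ _) h3.
- by rewrite -cat1s catA.
rewrite mulSn; apply: leq_add => //; exact: cost_basic_le insB.
Qed.

End Recovery.

(** * EXPLODE separates the branches *)

Section Explode.
Variables (R : realType) (V : finType) (e : rel V) (W : {set V}).
Variables (d : V -> V -> R).
Hypothesis dm : tree_metric e d.
Hypothesis low_degree : forall v, (degree e v <= 2)%N -> v \in W.
Local Notation L := {v : V | v \in W}.
Local Notation btw := (between d).
Local Notation br := (same_branch d).
Variable choice : {fset node L} -> node L.
Hypothesis choice_in : forall A, A != fset0 -> choice A \in A.
Local Notation recovery := (recovery e d).
Local Notation nonrep B := (bset B `\ brep B).

(** Partitioning the region of a bag without moving its representative discovers
    no new node, and keeps the edges that touch a region. *)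
Lemma recovery_replace (f : node L -> V) B (bs rest : seq (bag R L)) E c :
  recovery f (B :: rest) E c ->
  every (fun C => represents d f c C (region d f C) /\ brep C = brep B) bs ->
  (forall v, overlap d f bs v = (v \in region d f B)) ->
  recovery f (bs ++ rest) E c.
Proof.
move=> rec bsP covE.
have covS v : overlap d f (bs ++ rest) v = overlap d f (B :: rest) v.
  by rewrite overlap_cat covE.
have nodesE x : x \in nodes E (bs ++ rest) -> x \in nodes E (B :: rest).
  rewrite /nodes !mem_cat => /orP[->//|/orP[->|]]; rewrite ?orbT //.
  rewrite map_cat mem_cat /= inE => /orP[|->]; last by rewrite !orbT.
  elim: (bs) bsP => //= C s IH /every_cons[[_ h] /IH hs].
  by rewrite inE => /orP[|/hs//]; rewrite h => ->; rewrite !orbT.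
case: rec => h1 /every_cons[_ h2] h3 h4 h5 h6 h7 h8; split=> //.
- by apply/every_cat; split=> //; apply: every_imp bsP => C [].
- by move=> v; rewrite covS.
- by move=> x y /nodesE xN /nodesE yN; exact: h4.
- by move=> x /nodesE; rewrite covS; exact: h5.
- by move=> i /nodesE; exact: h6.
- by move=> x y /h8; rewrite !covS.
Qed.

Lemma bsize_nonrep (B : bag R L) : brep B \in bset B ->
  bsize B = #|` nonrep B|.+1.
Proof. by move=> h; rewrite /bsize (cardfsD1 (brep B)) h. Qed.

Lemma card_nonrep (f : node L -> V) c (B : bag R L) : labels f -> represents d f c B (region d f B) ->
  #|` nonrep B| = #|[set w : L | val w \in region d f B]%SET|.
Proof.
move=> lab g; rewrite cardE -(size_map (fun w : L => inl w : node L)).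
apply/perm_size/uniq_perm; first exact: fset_uniq.
  by rewrite map_inj_uniq ?enum_uniq // => x y [].
move=> x; rewrite (bag_mem_region lab g); case: x => [w|i].
  by rewrite mem_map ?mem_enum ?inE // => x y [].
by apply/esym/negP => /mapP[].
Qed.

(** Disjoint regions share out the regular vertices.  This bounds both the queries
    of a pass and the total size of its output. *)
Lemma sum_nonrep (f : node L -> V) c (K : {set V}) (bs : seq (bag R L)) : labels f ->
  every (fun B => represents d f c B (region d f B)) bs ->
  every (fun B => region d f B \subset K) bs ->
  (forall v, (overlap d f bs v <= 1)%N) ->
  (\sum_(B <- bs) #|` nonrep B| <= #|[set w : L | val w \in K]%SET|)%N.
Proof.
move=> lab gs sub disj.
apply: (@leq_trans (\sum_(w : L) overlap d f bs (val w))%N).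
  elim: bs gs {sub disj} => [|B bs IH]; first by rewrite big_nil.
  move=> /every_cons[g /IH h]; rewrite big_cons (card_nonrep lab g) /overlap.
  rewrite big_split /= leq_add // -sum1_card big_mkcond /=.
  by apply: leq_sum => w _; rewrite inE; case: (_ \in _).
rewrite -sum1_card [X in (_ <= X)%N]big_mkcond /=; apply: leq_sum => w _.
rewrite inE; case: ifP => // wK; rewrite leqn0; apply/eqP.
rewrite /overlap; elim: bs sub {gs disj} => //= B bs IH /every_cons[h /IH ->].
by rewrite addn0; apply/eqP; rewrite eqb0; apply: contraFN wK => /(fintype.subsetP h).
Qed.

Definition one_branch (f : node L -> V) (C : bag R L) := forall v w,
  v \in region d f C -> (w \in region d f C) = br (f (brep C)) v w.

(** The number of branches that EXPLODE has to separate, hence of its iterations. *)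
Definition branch_count (f : node L -> V) (B : bag R L) :=
  #|[set y | e (f (brep B)) y && (y \in region d f B)]%SET|.

Definition exploded (f : node L -> V) (B C : bag R L) :=
  [/\ (1 < bsize C)%N, region d f C \subset region d f B & one_branch f C].

(** Two nodes are in the same branch at [brep B] exactly if the triangle
    inequality through [brep B] is strict, which is the test of the algorithm. *)
Lemma explode_step dd (f : node L -> V) (B : bag R L) u rest E c : recovery f (B :: rest) E c ->
  agree d dd B -> u \in nonrep B ->
  let A := nonrep B in
  let du := result dd (get_dists B (enum_fset A) u) in
  let dr := result dd (get_dists B (enum_fset A) (brep B)) in
  let Bs := brep B |` [fset v in A | du v < dr u + dr v] in
  let B1 := Bag Bs (brep B) (bdist B) in
  let B2 := Bag (brep B |` (bset B `\` Bs)) (brep B) (bdist B) in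
  [/\ recovery f (B1 :: B2 :: rest) E c, exploded f B B1,
      region d f B2 \subset region d f B, (bsize B2 < bsize B)%N &
      (branch_count f B2 < branch_count f B)%N].
Proof.
move=> rec ag uA A du dr Bs B1 B2.
have lab := recovery_labels rec.
have gB : represents d f c B (region d f B) by have /every_cons[] := recovery_bags rec.
have inA := bag_mem_region lab gB.
have AB x : x \in A -> x \in bset B by rewrite in_fsetD1 => /andP[].
have regA x : x \in A -> is_regular x by rewrite inA; case: x.
have duE x : x \in A -> du x = d (f x) (f u).
  move=> xA; rewrite /du result_get_dists // (get_distE dm lab gB ag) ?AB //.
  by rewrite regA ?orbT.
have drE x : x \in A -> dr x = d (f x) (f (brep B)).
  move=> xA; rewrite /dr result_get_dists // (get_distE dm lab gB ag) ?eqxx //.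
    exact: AB.
  exact: (bag_rep gB).
set p := f (brep B).
have BsE x : (x \in Bs) = (x == brep B) || ((x \in A) && br p (f u) (f x)).
  have hA : (x != brep B) && (x \in bset B) = (x \in A) by rewrite in_fsetD1.
  rewrite in_fset1U !inE /= !hA; congr (_ || _); case xA : (x \in A) => //=.
  rewrite duE // !drE // /same_branch /between (tm_sym dm p (f x)).
  rewrite (tm_sym dm (f x) (f u)) lt_neqAle [in LHS]eq_sym andb_idr // => _.
  by have := tm_tri dm (f u) (f x) p; rewrite (tm_sym dm p).
have [K KE] : exists K, K = region d f B by eexists.
rewrite -KE in gB inA.
have [w0 uw w0K] : exists2 w : L, u = inl w & val w \in K.
  by move: uA; rewrite inA; case: (u) => // w h; exists w.
have fu : f u = val w0 by rewrite uw lab.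
pose K1 := [set v in K | br p (f u) v]%SET.
pose K2 := [set v in K | ~~ br p (f u) v]%SET.
have rhoB1 : brep B1 \in bset B1 by rewrite BsE eqxx.
have g1 : represents d f c B1 K1.
  split; rewrite /= -/p.
  - exact: rhoB1.
  - exact: (bag_fresh gB).
  - by rewrite inE negb_and (bag_notin gB).
  - move=> v w; rewrite !inE => /andP[vK h1] h2.
    by rewrite (bag_closed gB vK h2) (branch_trans dm h1 h2).
  - move=> x; rewrite BsE => /orP[->//|/andP[xA h] _].
    move: (xA); rewrite inA; case: x xA h => // w xA h wK; exists w => //.
    by rewrite inE wK -(lab w).
  - move=> w; rewrite inE => /andP[wK h]; rewrite BsE inA wK lab h /=.
    by rewrite orbT.
  - move=> x; rewrite BsE => /orP[->//|/andP[xA h]].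
    exact: (bag_dist gB (AB _ xA)).
have B2E x : (x \in bset B2) = (x == brep B) || ((x \in A) && ~~ br p (f u) (f x)).
  rewrite /= in_fset1U in_fsetD BsE negb_or negb_and.
  have [//|xr] := eqVneq x (brep B); rewrite /= in_fsetD1 xr /=.
  by case: (x \in bset B); rewrite ?andbF ?andbT.
have g2 : represents d f c B2 K2.
  split; rewrite -/p.
  - by rewrite B2E eqxx.
  - exact: (bag_fresh gB).
  - by rewrite inE negb_and (bag_notin gB).
  - move=> v w; rewrite !inE => /andP[vK h1] h2.
    rewrite (bag_closed gB vK h2) /=; apply: contra h1 => h3.
    by apply: (branch_trans dm h3); rewrite (branch_sym dm).
  - move=> x; rewrite B2E => /orP[->//|/andP[xA h] _].
    move: (xA); rewrite inA; case: x xA h => // w xA h wK; exists w => //.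
    by rewrite inE wK -(lab w).
  - move=> w; rewrite inE => /andP[wK h]; rewrite B2E inA wK lab h /=.
    by rewrite orbT.
  - move=> x; rewrite B2E => /orP[->//|/andP[xA h]].
    exact: (bag_dist gB (AB _ xA)).
have r1 := bag_region dm low_degree lab g1.
have r2 := bag_region dm low_degree lab g2.
have up : f u != p.
  by rewrite fu; apply: contraTneq w0K => ->; exact: (bag_notin gB).
split.
- have -> : [:: B1, B2 & rest] = [:: B1; B2] ++ rest by [].
  apply: (recovery_replace rec); last first.
    move=> v; rewrite /overlap /= r1 r2 -KE !inE addn0.
    by case: (v \in K) => //=; case: (br _ _ _).
  apply/every_cons; split; first by rewrite r1.
  by apply/every_cons; split; first by rewrite r2.
- split.
  + rewrite bsize_nonrep // ltnS cardfs_gt0; apply/fset0Pn; exists u.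
    rewrite in_fsetD1 /= BsE uA (branch_refl dm up) orbT andbT.
    by move: uA; rewrite in_fsetD1 => /andP[].
  + by rewrite r1 -KE; apply/fintype.subsetP => v; rewrite inE => /andP[].
  + move=> v w; rewrite r1 !inE => /andP[vK h]; apply/andP/idP => [[wK h']|h'].
      by rewrite (branch_sym dm) in h; exact: (branch_trans dm h h').
    by rewrite (bag_closed gB vK h') (branch_trans dm h h').
- by rewrite r2 -KE; apply/fintype.subsetP => v; rewrite inE => /andP[].
- apply: fproper_ltn_card; rewrite fproperE; apply/andP; split.
    apply/fsubsetP => x; rewrite B2E => /orP[/eqP->|/andP[/AB//]].
    exact: (bag_rep gB).
  apply/negP => /fsubsetP/(_ u (AB _ uA)).
  rewrite B2E uA (branch_refl dm up) orbF.
  by move: uA; rewrite in_fsetD1 => /andP[/negPf->].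
rewrite /branch_count r2 -/p -KE; apply: proper_card; apply/properP; split.
  by apply/fintype.subsetP => y; rewrite !inE => /andP[-> /andP[->]].
have [y [py _ by_]] := neighbor_toward dm up; exists y.
  rewrite inE py; apply: (bag_closed gB w0K).
  by rewrite -fu.
by rewrite !inE by_ !andbF.
Qed.

Lemma explode_loop_recovery dd (f : node L -> V) E c fuel :
  forall (B : bag R L) rest,
  recovery f (B :: rest) E c -> agree d dd B -> (bsize B <= fuel)%N ->
  let Cs := result dd (explode_loop choice fuel B) in
  [/\ recovery f (Cs ++ rest) E c, every (exploded f B) Cs &
      (cost dd (explode_loop choice fuel B) <=
         branch_count f B * (2 * #|` nonrep B|))%N].
Proof.
elim: fuel => [|fuel IH] B rest rec ag le.
  have gB : represents d f c B (region d f B) by have /every_cons[] := recovery_bags rec.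
  by move: le; rewrite bsize_nonrep //; exact: (bag_rep gB).
have lab := recovery_labels rec.
have gB : represents d f c B (region d f B) by have /every_cons[] := recovery_bags rec.
rewrite [explode_loop _ _ _]/=; case: ifP => [B1|B1]; last first.
  split=> //; apply: (recovery_replace (bs := [::]) rec) => // v.
  rewrite /overlap /=; apply/esym/eqP; rewrite eqb0; apply/negP => vK.
  have := card_nonrep lab gB; have := bsize_nonrep (bag_rep gB).
  move=> h1 h2; move: B1; rewrite h1 h2 ltnS => /negbT; rewrite -leqNgt leqn0.
  rewrite cards_eq0 => /eqP/setP h.
  move: vK; rewrite inE => /existsP[w /and3P[wB wr hw]].
  have [w' [ww] w'K] := bag_mem gB wB wr.
  by have := h w'; rewrite finset.in_set w'K finset.in_set0.
set A := nonrep B; set u := choice A.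
have uA : u \in A.
  by apply: choice_in; rewrite -cardfs_gt0 -ltnS -bsize_nonrep ?(bag_rep gB).
have := explode_step rec ag uA.
rewrite !result_bind !cost_bind -/A.
set du := result dd (get_dists B _ u); set dr := result dd (get_dists B _ _).
set Bs := (_ |` _); set C1 := Bag Bs _ _; set C2 := Bag (_ |` _) _ _.
move=> [rec1 ex1 sub2 lt2 nb2].
have rec2 : recovery f (C2 :: (C1 :: rest)) E c.
  by apply: recovery_perm rec1 => P /=; rewrite addnCA.
have subB x : x \in bset C2 -> x \in bset B.
  rewrite /= in_fset1U in_fsetD => /orP[/eqP->|/andP[]//].
  exact: (bag_rep gB).
have ag2 : agree d dd C2 by move=> a b /subB aB /subB bB; exact: ag.
have le2 : (bsize C2 <= fuel)%N by rewrite -ltnS; apply: leq_trans le.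
have [rec3 ex3 cost3] := IH C2 _ rec2 ag2 le2.
rewrite !result_ret !cost_ret addn0 /=; split.
- apply: recovery_perm rec3 => P; rewrite -cat_cons -cat1s !count_cat /=.
  by rewrite addn0 addnCA addnA.
- apply/every_cons; split=> //; apply: every_imp ex3 => C [h1 h2 h3]; split=> //.
  exact: fintype.subset_trans h2 sub2.
apply: (@leq_trans (2 * #|` A| + branch_count f C2 * (2 * #|` A|))%N).
  rewrite addnA; apply: leq_add.
    rewrite mul2n -addnn; apply: leq_add; apply: leq_trans (cost_get_dists _ _ _ _) (count_size _ _).
  apply: leq_trans cost3 _; rewrite leq_mul2l leq_mul2l /=.
  apply/orP; right; apply: fsubset_leq_card; apply/fsubsetP => x.
  by rewrite !in_fsetD1 => /andP[-> /subB].
by rewrite -mulSn leq_mul2r nb2 orbT.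
Qed.

Lemma explode_all_recovery dd (f : node L -> V) E c Delta
  (T : {set V} -> Prop) (bs : seq (bag R L)) :
  (max_degree e <= Delta)%N ->
  (forall Z Z' : {set V}, T Z -> Z' \subset Z -> T Z') -> forall rest,
  recovery f (bs ++ rest) E c -> every (agree d dd) bs ->
  every (fun B => T (region d f B)) bs ->
  let Cs := result dd (explode_all choice bs) in
  [/\ recovery f (Cs ++ rest) E c,
      every (fun C => [/\ (1 < bsize C)%N, one_branch f C & T (region d f C)]) Cs &
      (cost dd (explode_all choice bs) <=
         \sum_(B <- bs) Delta * (2 * #|` nonrep B|))%N].
Proof.
move=> degD Tsub; elim: bs => [|B bs IH] rest rec.
  by rewrite big_nil.
move=> /every_cons[agB ags] /every_cons[TB Ts].
have [rec1 ex1 cost1] := explode_loop_recovery rec agB (leqnn _).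
have rec2 : recovery f (bs ++ (result dd (explode choice B) ++ rest)) E c.
  by apply: recovery_perm rec1 => P; rewrite !count_cat addnCA.
have [rec3 ex3 cost3] := IH _ rec2 ags Ts.
rewrite [explode_all _ _]/= !result_bind !cost_bind big_cons.
rewrite !result_ret !cost_ret addn0 /=; split.
- by apply: recovery_perm rec3 => P; rewrite !count_cat addnCA addnA.
- apply/every_cat; split=> //; apply: every_imp ex1 => C [h1 h2 h3]; split=> //.
  exact: Tsub h2.
apply: leq_add => //.
apply: leq_trans cost1 _; rewrite leq_mul2r; apply/orP; right.
apply: leq_trans degD; apply: leq_trans (leq_bigmax (f (brep B))).
by apply: subset_leq_card; apply/fintype.subsetP => y; rewrite !inE => /andP[].
Qed.

End Explode.

(** * A pass of BIGSPLIT, and small bags *)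

Section Passes.
Variables (R : realType) (V : finType) (e : rel V) (W : {set V}).
Variables (d : V -> V -> R).
Hypothesis dm : tree_metric e d.
Hypothesis low_degree : forall v, (degree e v <= 2)%N -> v \in W.
Local Notation L := {v : V | v \in W}.
Local Notation btw := (between d).
Local Notation br := (same_branch d).
Variable choice : {fset node L} -> node L.
Hypothesis choice_in : forall A, A != fset0 -> choice A \in A.
Local Notation recovery := (recovery e d).
Local Notation nonrep B := (bset B `\ brep B).
Local Notation dW := (fun a b : L => d (val a) (val b)).

(** The bags returned by a pass have this form, whatever the sample; the sample
    only decides for which [q]. *)
Definition branch_nodes (q v : V) : {fset node L} :=
  [fset x in [seq (inl w : node L) | w <- enum [set w : L | br q v (val w)]%SET]].

Lemma mem_branch_nodes q v x : (x \in branch_nodes q v) =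
  if x is inl w then br q v (val w) else false.
Proof.
rewrite /branch_nodes in_fset /=; apply/mapP/idP => [[w]|].
  by rewrite mem_enum inE => h ->.
by case: x => // w h; exists w => //; rewrite mem_enum inE.
Qed.

Lemma branch_nodes_chain p v q q' : btw p q v -> btw p q' v ->
  branch_nodes q v `<=` branch_nodes q' v \/ branch_nodes q' v `<=` branch_nodes q v.
Proof.
move=> h h'; case: (btw_total dm h h') => k; [right|left]; apply/fsubsetP => x;
rewrite !mem_branch_nodes; case: x => // w; exact: (branch_nested dm _ _ k).
Qed.

Lemma agree_dist (bs : seq (bag R L)) : every (agree d dW) bs.
Proof. by elim: bs => // B bs h; apply/every_cons. Qed.

(** A bag [C] returned by the pass is a single branch at a vertex [q].  Since the
    branch does not contain the representative of [B], its nodes are beyond [q],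
    so that [C] belongs to the chain of branches around each of its nodes. *)
Lemma bigsplit_pass_recovery Delta (f : node L -> V) (B : bag R L) Q E0 us c :
  (max_degree e <= Delta)%N -> recovery f (B :: Q) E0 c ->
  exists f' Cs E' c',
  [/\ result dW (bigsplit_pass choice B us c) = (Cs, E', c'),
      recovery f' (Cs ++ Q) (E0 ++ E') c' /\ (c <= c')%N,
      every (fun C => [/\ (1 < bsize C)%N, brep C \in bset C,
         nonrep C `<=` nonrep B, (forall x, x \in us -> x \notin nonrep C) &
         forall w : L, inl w \in nonrep C -> exists2 q,
           btw (f (brep B)) q (val w) & nonrep C = branch_nodes q (val w)]) Cs,
      (\sum_(C <- Cs) (bsize C).-1 <= (bsize B).-1)%N &
      (cost dW (bigsplit_pass choice B us c) <=
        size us * (2 * bsize B) + Delta * (2 * (bsize B).-1))%N].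
Proof.
move=> degD rec.
have gB : represents d f c B (region d f B) by have /every_cons[] := recovery_bags rec.
have lab := recovery_labels rec.
have insB : every (inside d f (region d f B) (bset B) [::]) [:: B].
  by apply/every_cons; split.
have rec0 : recovery f ([:: B] ++ Q) (E0 ++ [::]) c by rewrite cats0.
have [f1 [bs [E' [c' [resE rec1 cc ins1 cost1]]]]] :=
  splits_recovery dm low_degree choice_in us (dd := dW) (fun _ _ _ _ => erefl) rec0 insB.
pose T (Z : {set V}) := Z \subset region d f B /\
  forall w : L, inl w \in us -> val w \notin Z.
have Tsub (Z Z' : {set V}) : T Z -> Z' \subset Z -> T Z'.
  move=> [h1 h2] h; split; first exact: fintype.subset_trans h1.
  by move=> w /h2; apply: contra; apply/fintype.subsetP.
have Tbs : every (fun C => T (region d f1 C)) bs.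
  by apply: every_imp ins1 => C [h1 _ h2]; split.
have [rec2 ex cost2] := explode_all_recovery dm low_degree choice_in degD Tsub
  rec1 (agree_dist bs) Tbs.
move: rec2 ex cost2; set Cs := result _ _ => rec2 ex cost2.
have lab1 := recovery_labels rec2.
have gCs : every (fun C => represents d f1 c' C (region d f1 C)) Cs.
  by have /every_cat[] := recovery_bags rec2.
have nB : #|` nonrep B| = (bsize B).-1 by rewrite bsize_nonrep ?(bag_rep gB).
have sum_le (xs : seq (bag R L)) Q' E1 : recovery f1 (xs ++ Q') E1 c' ->
    every (fun C => T (region d f1 C)) xs ->
    (\sum_(C <- xs) #|` nonrep C| <= (bsize B).-1)%N.
  move=> recx Tx; rewrite -nB (card_nonrep lab gB).
  apply: (sum_nonrep (d := d) (c := c') (recovery_labels recx)).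
  - by have /every_cat[] := recovery_bags recx.
  - by apply: every_imp Tx => C [].
  - move=> v; apply: leq_trans (recovery_disjoint recx v).
    by rewrite overlap_cat leq_addr.
exists f1, Cs, E', c'; split.
- by rewrite /bigsplit_pass !result_bind resE /= result_bind.
- by split; [exact: rec2|exact: cc].
- apply: every_imp (every_and ex gCs) => C [[h1 h2 [h3 h4]] gC].
  have subC : nonrep C `<=` nonrep B.
    apply/fsubsetP => x; rewrite (bag_mem_region lab1 gC) (bag_mem_region lab gB).
    by case: x => // w; apply/fintype.subsetP.
  split=> //; first exact: (bag_rep gC).
    move=> x xus; rewrite (bag_mem_region lab1 gC).
    by case: x xus => // w /h4.
  move=> w; rewrite (bag_mem_region lab1 gC) => wC.
  exists (f1 (brep C)).
    apply: contraT => h; have pC : f (brep B) \in region d f1 C.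
      by rewrite (h2 _ _ wC) (branch_sym dm).
    by have := bag_notin gB; rewrite (fintype.subsetP h3 _ pC).
  apply/fsetP => x; rewrite (bag_mem_region lab1 gC) mem_branch_nodes.
  by case: x => // w'; rewrite (h2 _ _ wC).
- apply: leq_trans (sum_le _ _ _ rec2 _); last by apply: every_imp ex => C [].
  elim: Cs gCs {rec2 ex cost2} => [|C Cs IH]; first by rewrite !big_nil.
  move=> /every_cons[gC /IH h]; rewrite !big_cons leq_add //.
  by rewrite bsize_nonrep ?(bag_rep gC).
rewrite /bigsplit_pass !cost_bind resE /= !cost_bind cost_ret addn0.
apply: leq_add cost1 _; apply: leq_trans cost2 _.
rewrite -big_distrr leq_mul2l; apply/orP; right.
rewrite -big_distrr leq_mul2l; apply/orP; right.
exact: (sum_le _ _ _ rec1).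
Qed.

(** The table is filled in one order only, so that half of its entries rely on the
    symmetry of the distance. *)
Lemma dist_tableP (B : bag R L) (s : seq (node L)) a b :
  inl a \in s -> inl b \in s ->
  result dW (dist_table B s) (inl a) (inl b) = d (val a) (val b).
Proof.
elim: s => // x s IH; rewrite [dist_table _ _]/= !result_bind result_ret.
rewrite !inE => ha hb; case: (eqVneq (inl a) (inl b : node L)) => [[->]|ab].
  by rewrite (tm_id dm).
case: eqVneq ha => [ax _|ax /= ha].
  have bs : inl b \in s by case/orP: hb => // /eqP bx; rewrite ax bx eqxx in ab.
  by rewrite result_get_dists // -ax /result /= (tm_sym dm).
case: eqVneq hb => [bx _|bx /= hb].
  by rewrite result_get_dists // -bx /result.
exact: IH.
Qed.

Lemma cost_dist_table (B : bag R L) s :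
  (cost dW (dist_table B s) <= size s * (size s).-1)%N.
Proof.
elim: s => // x s IH; rewrite [dist_table _ _]/= !cost_bind cost_ret addn0 /=.
apply: (@leq_trans (size s + size s * (size s).-1)%N).
  apply: leq_add => //; apply: leq_trans (cost_get_dists _ _ _ _) (count_size _ _).
by case: (size s) => //= n; rewrite -mulnS leq_mul2r ltnW ?orbT.
Qed.

Lemma recovery_drop (f : node L -> V) (bs Q : seq (bag R L)) E c :
  recovery f (bs ++ Q) E c -> every (fun C => region d f C = finset.set0) bs ->
  recovery f Q E c.
Proof.
elim: bs => // C bs IH rec /every_cons[h hs]; apply: IH => //.
apply: (@recovery_replace _ _ _ _ _ _ C [::] _ _ _ rec) => // v.
by rewrite h inE.
Qed.

(** Once every node of the bag has served as a pivot no regular vertex is left in a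
    region, and a nonempty region contains one. *)
Lemma solve_recovery (f : node L -> V) (B : bag R L) Q E0 c :
  recovery f (B :: Q) E0 c ->
  exists f' E' c',
  [/\ result dW (solve choice B c) = (E', c'), recovery f' Q (E0 ++ E') c' &
      (cost dW (solve choice B c) <= bsize B * (bsize B).-1)%N].
Proof.
move=> rec.
have gB : represents d f c B (region d f B) by have /every_cons[] := recovery_bags rec.
have lab := recovery_labels rec.
have insB : every (inside d f (region d f B) (bset B) [::]) [:: B].
  by apply/every_cons; split.
have rec0 : recovery f ([:: B] ++ Q) (E0 ++ [::]) c by rewrite cats0.
set us := enum_fset (nonrep B).
pose tab := result dW (dist_table B (enum_fset (bset B))).
have [f1 [bs [E' [c' [resE rec1 cc ins1 cost1]]]]] :=
  splits_recovery dm low_degree choice_in us (dd := fun a b => tab (inl a) (inl b))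
  (fun a b aB bB => dist_tableP _ aB bB) rec0 insB.
exists f1, E', c'; split.
- by rewrite /solve result_bind -/tab -/us [run_prog _ _](surjective_pairing _);
   rewrite -/(result _ _) resE.
- apply: (recovery_drop rec1).
  have gs : every (fun C => represents d f1 c' C (region d f1 C)) bs.
    by have /every_cat[] := recovery_bags rec1.
  apply: every_imp (every_and gs ins1) => C [gC [h1 h2 h3]].
  apply/eqP/set0Pn => -[v vC]; move: (vC); rewrite inE.
  move=> /existsP[w /and3P[wC wr _]].
  have [w' [ww] w'C] := bag_mem gC wC wr.
  have /h3 : inl w' \in us.
    by rewrite (bag_mem_region lab gB); apply: (fintype.subsetP h1).
  by rewrite w'C.
rewrite /solve cost_bind -/tab; case: (run_prog _ _).2 => [[? ?] ?].
by rewrite cost_ret addn0; exact: cost_dist_table.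
Qed.
End Passes.

(** * How often a sample misses a large branch *)

Section Words.
Variable T : eqType.

(** The possible samples of [k] distinct elements, without repetition. *)
Fixpoint words (k : nat) (s : seq T) : seq (seq T) :=
  if k is k'.+1 then [seq x :: w | x <- s, w <- words k' (rem x s)]
  else [:: [::]].

Lemma size_words k s : size (words k s) = size s ^_ k.
Proof.
elim: k s => [|k IH] s; first by rewrite ffactn0.
rewrite /= size_allpairs_dep ffactnS.
have -> : [seq size (words k (rem x s)) | x <- s] = nseq (size s) ((size s).-1 ^_ k).
  apply: (@eq_from_nth _ 0%N); rewrite size_map ?size_nseq // => i lt.
  case: s lt => // x0 s lt.
  by rewrite (nth_map x0) // nth_nseq lt IH size_rem // mem_nth.
by rewrite sumn_nseq mulnC.
Qed.

Lemma mem_words k s w : uniq s ->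
  (w \in words k s) = [&& size w == k, uniq w & all (mem s) w].
Proof.
elim: k s w => [|k IH] s w us.
  by rewrite inE; case: w.
apply/allpairsPdep/idP => [[x [v [xs vs ->]]]|].
  move: vs; rewrite IH ?rem_uniq //= => /and3P[/eqP-> -> /allP h].
  rewrite eqxx xs /=; apply/andP; split; last first.
    by apply/allP => y /h; rewrite /= mem_rem_uniq // inE => /andP[].
  rewrite andbT; apply/negP => /h; by rewrite /= mem_rem_uniq // inE eqxx.
case: w => // x w /and3P[]; rewrite [size _]/= eqSS => sw /= /andP[xw uw].
move=> /andP[xs /allP h]; exists x, w; split=> //.
rewrite IH ?rem_uniq // sw uw /=; apply/allP => y yw /=.
rewrite mem_rem_uniq // inE; have := h _ yw => /= ->; rewrite andbT.
by apply: contraNneq xw => <-.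
Qed.

Lemma words_uniq k s : uniq s -> uniq (words k s).
Proof.
elim: k s => // k IH s us /=; apply: allpairs_uniq_dep => //.
  by move=> x xs; apply: IH; exact: rem_uniq.
by move=> [x w] [y v] _ _ /= [-> ->].
Qed.

Lemma count_words_avoid k s (H : pred T) : uniq s ->
  count (fun w => ~~ has H w) (words k s) =
  (size s - count H s) ^_ k.
Proof.
move=> us; rewrite -size_filter.
have <- : size [seq x <- s | predC H x] = (size s - count H s)%N.
  by rewrite size_filter -(count_predC H s) addKn.
rewrite -size_words; apply/perm_size/uniq_perm.
- by rewrite filter_uniq // words_uniq.
- by rewrite words_uniq // filter_uniq.
move=> w; rewrite mem_filter !mem_words ?filter_uniq //.
rewrite andbC -!andbA; congr (_ && (_ && _)).
rewrite -all_predC -all_predI; apply: eq_all => x /=.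
by rewrite mem_filter andbC.
Qed.

End Words.

Lemma sum_nat_of_bool (I : Type) (s : seq I) (P : pred I) :
  (\sum_(x <- s) P x = count P s)%N.
Proof. by rewrite -sum1_count [RHS]big_mkcond; apply: eq_bigr => x _; case: (P x). Qed.

Lemma leq_ffact k m n : (m <= n)%N -> (m ^_ k <= n ^_ k)%N.
Proof.
move=> mn; elim: k => [|k IH]; first by rewrite !ffactn0.
by rewrite !ffactnSr leq_mul // leq_sub2r.
Qed.

Section Fails.
Variables (T : choiceType) (A : {fset T}).
Variable F : T -> {fset T} -> Prop.
Hypothesis chain : forall x H1 H2, F x H1 -> F x H2 -> H1 `<=` H2 \/ H2 `<=` H1.

(** A member of minimal cardinality among those with at least [h] elements is the
    least one, because they form a chain.  If there is none, any set will do. *)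
Lemma least_heavy (h : nat) x : exists H : {fset T}, forall C,
  F x C -> C `<=` A -> (h <= #|` C|)%N ->
  [/\ H `<=` C, H `<=` A & (h <= #|` H|)%N].
Proof.
have [[C0 C0P]|no] := pselect (exists C, [/\ F x C, C `<=` A & (h <= #|` C|)%N]).
  have : exists n, `[< exists C, [/\ F x C, C `<=` A, (h <= #|` C|)%N & #|` C| = n] >].
    by case: C0P => *; exists #|` C0|; apply/asboolP; exists C0.
  move=> /ex_minnP[n /asboolP[H [FH HA hH Hn]] nmin]; exists H => C FC CA hC.
  split=> //; case: (chain FH FC) => // CH.
  have le : (n <= #|` C|)%N by apply: nmin; apply/asboolP; exists C.
  suff -> : C = H by [].
  apply/eqP; have := fsubset_leqif_cards CH; case=> _ <-.
  by rewrite eqn_leq Hn le andbT -Hn fsubset_leq_card.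
by exists fset0 => C FC CA hC; case: no; exists C.
Qed.

(** Markov's inequality for the number of nodes [x] whose least heavy set [H x] is
    missed by the sample: a missed set [C] with at least [h] elements contributes
    all its elements, as [H x] is contained in [C] for each [x] in [C]. *)
Lemma count_fails (h k : nat) (a : pred (seq T)) : (0 < h)%N ->
  (forall w, a w -> exists C, [/\ C `<=` A, (h <= #|` C|)%N,
     forall x, x \in C -> F x C & forall x, x \in w -> x \notin C]) ->
  (count a (words k (enum_fset A)) * h <= #|` A| * (#|` A| - h) ^_ k)%N.
Proof.
move=> h0 aP; have [H HP] := choice (least_heavy h).
pose missed x (w : seq T) := (h <= #|` H x|)%N && (H x `<=` A) && ~~ has (mem (H x)) w.
apply: (@leq_trans (\sum_(w <- words k (enum_fset A)) \sum_(x <- enum_fset A) missed x w)).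
  elim: (words _ _) => [|w ws IH]; first by rewrite big_nil.
  rewrite big_cons /= mulnDl; apply: leq_add => //.
  case: (boolP (a w)) => // /aP[C [CA hC FC Cw]]; rewrite mul1n.
  apply: (leq_trans hC); rewrite sum_nat_of_bool -size_filter.
  apply: uniq_leq_size; first exact: fset_uniq.
  move=> x xC; rewrite mem_filter (fsubsetP CA _ xC) andbT /missed.
  have [HC HA hH] := HP x C (FC x xC) CA hC.
  rewrite hH HA /=; apply/hasPn => y yw /=.
  by apply: contra (Cw _ yw); exact: (fsubsetP HC).
rewrite exchange_big /=.
apply: (@leq_trans (\sum_(x <- enum_fset A) (#|` A| - h) ^_ k)); last first.
  by rewrite big_const_seq count_predT iter_addn_0 mulnC.
apply: leq_sum => x _; rewrite sum_nat_of_bool /missed.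
have [/andP[hH HA]|_] := boolP ((h <= #|` H x|)%N && (H x `<=` A)); last first.
  by rewrite count_pred0.
rewrite count_words_avoid ?fset_uniq //; apply: leq_ffact; apply: leq_sub2l.
apply: leq_trans hH _; rewrite -size_filter; apply: uniq_leq_size.
  exact: fset_uniq.
by move=> y yH; rewrite mem_filter /= yH (fsubsetP HA).
Qed.
End Fails.

(** Drawing without replacement misses a set of size [h] at most as often as drawing
    with replacement. *)
Lemma ffact_ratio k m h : ((m - h) ^_ k * m ^ k <= m ^_ k * (m - h) ^ k)%N.
Proof.
elim: k => [|k IH]; first by rewrite !ffactn0 !expn0.
rewrite !ffactnSr !expnSr !(mulnACA _ _ (_ ^ k)%N); apply: leq_mul => //.
have [mk|km] := leqP m k; first by rewrite (_ : m - h - k = 0)%N ?mul0n //; lia.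
have [mh|hm] := leqP m h; first by rewrite (_ : m - h = 0)%N ?sub0n ?mul0n //; lia.
have [mhk|hkm] := leqP (m - h) k; first by rewrite (_ : m - h - k = 0)%N ?mul0n //; lia.
nia.
Qed.

Section FailFraction.
Variable R : realType.

(** Here [s] is the square root of Delta, and [x = s - 1 + 1/s] is a lower bound for
    the expected number of sampled nodes in a set of the critical size. *)
Lemma poly_bound (s x : R) : 1 < s -> s * x = s ^+ 2 - s + 1 ->
  10 * s ^+ 2 <= 9 * (x * (1 + x / 2) ^+ 2).
Proof.
move=> s1 xE.
suff : 0 <= s ^+ 3 * (9 * (x * (1 + x / 2) ^+ 2) - 10 * s ^+ 2) * 4.
  by rewrite pmulr_lge0 // pmulr_rge0 ?exprn_gt0 ?subr_ge0 //; lra.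
have -> : s ^+ 3 * (9 * (x * (1 + x / 2) ^+ 2) - 10 * s ^+ 2) * 4 =
  9 * ((s * x) * (2 * s + s * x) ^+ 2) - 40 * s ^+ 5 by field.
rewrite xE.
have -> : 9 * ((s ^+ 2 - s + 1) * (2 * s + (s ^+ 2 - s + 1)) ^+ 2) - 40 * s ^+ 5
 = 9 * s^+6 - 31 * s^+5 + 18 * s^+4 + 9 * s^+3 + 18 * s^+2 + 9 * s + 9 by ring.
(* completing the square; all the coefficients of the remainder are positive *)
set q := 3 * s ^+ 3 - 31 / 6 * s ^+ 2 - 29 / 20 * s - 1.
have -> : 9 * s^+6 - 31 * s^+5 + 18 * s^+4 + 9 * s^+3 + 18 * s^+2 + 9 * s + 9 =
  q ^+ 2 + (1 / 180 * s ^+ 4 + 1 / 60 * s ^+ 3 + (18 - 29 ^+ 2 / 20 ^+ 2 - 31 / 3) * s ^+ 2 +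
   61 / 10 * s + 8) by rewrite /q; field.
have s0 : 0 <= s by lra.
by rewrite !addr_ge0 ?sqr_ge0 ?mulr_ge0 ?exprn_ge0 //; lra.
Qed.

(** With [z = h Delta / m], the failure probability is at most
    (Delta/z)(1 - h/m)^Delta, hence at most (Delta/z) exp(-z).  The estimate of
    exp(z) by (1 + z/2)^2 from below leaves an inequality between polynomials
    in the square root of Delta, which is tightest near Delta = 5. *)
Lemma fail_fraction (Delta m h c : nat) : (2 <= Delta)%N -> (Delta <= m)%N ->
  (m.+1)%:R / Num.sqrt (Delta%:R : R) < h.+1%:R ->
  (c * h <= m * (m - h) ^_ Delta)%N -> (10 * c <= 9 * m ^_ Delta)%N.
Proof.
move=> D2 Dm hlt ch.
have [mh|hm] := ltnP m h.
  have : (c * h <= 0)%N.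
    apply: leq_trans ch _; rewrite (_ : m - h = 0)%N; last by lia.
    by case: Delta D2 {Dm hlt} => [|k] // _; rewrite ffact0n muln0.
  by rewrite leqn0 muln_eq0 => /orP[/eqP->|/eqP h0]; rewrite ?muln0 //; lia.
set s : R := Num.sqrt Delta%:R.
have sE : s ^+ 2 = Delta%:R by rewrite sqr_sqrtr.
have s1 : 1 < s.
  by rewrite -(@ltr_pXn2r _ 2) ?nnegrE ?sqrtr_ge0 // sE expr1n (ltr_nat _ 1).
have s0 : 0 < s by lra.
have m0 : 0 < m%:R :> R by rewrite ltr0n; lia.
have mD : s ^+ 2 <= m%:R by rewrite sE ler_nat.
have hs : m%:R + 1 < (h%:R + 1) * s.
  by move: hlt; rewrite ltr_pdivrMr // -!natr1.
pose x := s - 1 + s^-1.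
have xE : s * x = s ^+ 2 - s + 1 by rewrite /x; field; lra.
have x0 : 0 < x by rewrite -(pmulr_rgt0 _ s0) xE; nra.
pose z : R := h%:R * Delta%:R / m%:R.
have h1 : (1 : R) < h%:R by rewrite -(ltr_pM2r s0); nra.
have xz : x <= z.
  rewrite /z -sE ler_pdivlMr // -(ler_pM2l s0) mulrA xE.
  have : s * (m%:R + 1 - s) <= s * (h%:R * s) by rewrite ler_pM2l //; lra.
  nra.
have pb := poly_bound s1 xE.
have zb : 10 * s ^+ 2 <= 9 * (z * (1 + z / 2) ^+ 2).
  apply: le_trans pb _; rewrite ler_pM2l //.
  by rewrite ler_pM ?exprn_ge0 ?lerXn2r ?nnegrE //; lra.
pose y : R := 1 - h%:R / m%:R.
have y0 : 0 <= y.
  by rewrite /y subr_ge0 ler_pdivrMr // mul1r ler_nat.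
have zy : y ^+ Delta * (1 + z / 2) ^+ 2 <= 1.
  have ye : y <= expR (- (h%:R / m%:R)) by rewrite /y; exact: expR_ge1Dx.
  have yD : y ^+ Delta <= expR (- z).
    apply: le_trans (_ : expR (- (h%:R / m%:R)) ^+ Delta <= _).
      by rewrite lerXn2r // nnegrE // expR_ge0.
    by rewrite -expRM_natl mulrN /z mulrCA mulrA.
  have z2 : (1 + z / 2) ^+ 2 <= expR z.
    have -> : expR z = expR (z / 2) ^+ 2 by rewrite -expRM_natl; congr expR; field.
    rewrite lerXn2r ?nnegrE ?expR_ge0 //; last exact: expR_ge1Dx.
    by lra.
  rewrite [leRHS](_ : 1 = expR (- z) * expR z); last by rewrite -expRD addNr expR0.
  by apply: ler_pM => //; rewrite ?sqr_ge0 ?exprn_ge0.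
have ffy : ((m - h) ^_ Delta)%:R <= (m ^_ Delta)%:R * y ^+ Delta.
  have : (((m - h) ^_ Delta * m ^ Delta)%N%:R : R) <= (m ^_ Delta * (m - h) ^ Delta)%N%:R.
    by rewrite ler_nat ffact_ratio.
  rewrite !natrM !natrX natrB //.
  have -> : m%:R - h%:R = m%:R * y :> R by rewrite /y; field; lra.
  rewrite exprMn mulrCA [X in X <= _]mulrC ler_pM2l //.
  exact: exprn_gt0.
have chR : c%:R * h%:R <= m%:R * ((m ^_ Delta)%:R * y ^+ Delta).
  apply: le_trans (_ : m%:R * ((m - h) ^_ Delta)%:R <= _).
    by rewrite -!natrM ler_nat.
  by rewrite ler_pM2l.
set M : R := (m ^_ Delta)%:R in ffy chR *.
set Y := (1 + z / 2) ^+ 2 in zb zy.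
have Y0 : 0 < Y by rewrite exprn_gt0 //; lra.
have M0 : 0 <= M by rewrite ler0n.
suff : 10 * c%:R <= 9 * M by rewrite -!natrM ler_nat.
have hY0 : 0 < h%:R * Y by rewrite mulr_gt0 //; lra.
rewrite -(ler_pM2r hY0).
have st1 : c%:R * h%:R * Y <= m%:R * M.
  apply: le_trans (ler_wpM2r (ltW Y0) chR) _.
  have -> : m%:R * (M * y ^+ Delta) * Y = m%:R * M * (y ^+ Delta * Y) by ring.
  by rewrite -[leRHS]mulr1 ler_wpM2l // mulr_ge0 // ltW.
have st2 : 10 * m%:R <= 9 * (h%:R * Y).
  have D0 : 0 < s ^+ 2 by rewrite exprn_gt0.
  rewrite -(ler_pM2r D0).
  have zE : z * m%:R = h%:R * s ^+ 2 by rewrite /z sE; field; lra.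
  have -> : 9 * (h%:R * Y) * s ^+ 2 = m%:R * (9 * (z * Y)).
    by transitivity (9 * Y * (z * m%:R)); [rewrite zE; ring|ring].
  by rewrite (mulrC 10) -mulrA ler_pM2l.
have -> : 10 * c%:R * (h%:R * Y) = 10 * (c%:R * h%:R * Y) by ring.
have -> : 9 * M * (h%:R * Y) = M * (9 * (h%:R * Y)) by ring.
apply: (@le_trans _ _ (10 * (m%:R * M))); first by lra.
have -> : 10 * (m%:R * M) = M * (10 * m%:R) by ring.
by rewrite ler_wpM2l.
Qed.
End FailFraction.

(** * Expectations along a process driven by independent samples *)

Section Chain.
Variables (R : realType) (L : finType) (disp : measure_display).
Variables (Omega : measurableType disp) (P : probability Omega R) (kappa : nat).
Variable smp : Omega -> nat -> {fset node L} -> seq (node L).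
Hypothesis smpP : uniform_samples P kappa smp.

Variables (S : Type) (A : S -> {fset node L}) (next : seq (node L) -> S -> S).
Variable I : S -> Prop.
Hypothesis next_I : forall us s, I s -> I (next us s).
Hypothesis enough : forall s, I s -> (kappa <= #|` A s|)%N.

Fixpoint chain_run (w : nat -> {fset node L} -> seq (node L)) k t s : S :=
  if t is t'.+1 then chain_run w k.+1 t' (next (w k (A s)) s) else s.

Lemma chain_run_last w k t s : chain_run w k t.+1 s =
  next (w (k + t)%N (A (chain_run w k t s))) (chain_run w k t s).
Proof.
elim: t k s => [|t IH] k s; first by rewrite /= addn0.
rewrite -[LHS]/(chain_run w k.+1 t.+1 (next (w k (A s)) s)) IH.
by rewrite addSnnS.
Qed.

(** There are countably many samples, and after fixing the first one the process
    starts again from a known state. *)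
Lemma chain_run_measurable t k s (X : set S) :
  measurable [set w | X (chain_run (smp w) k t s)].
Proof.
elim: t k s => [|t IH] k s /=.
  have [h|h] := pselect (X s).
    rewrite [X in measurable X](_ : _ = setT); first exact: measurableT.
    by apply/seteqP; split.
  rewrite [X in measurable X](_ : _ = classical_sets.set0); first exact: measurable0.
  by apply/seteqP; split.
rewrite [X in measurable X](_ : _ = (\bigcup_us ([set w | smp w k (A s) = us] `&`
   [set w | X (chain_run (smp w) k.+1 t (next us s))]))%classic); last first.
  apply/seteqP; split => w /=; first by move=> h; exists (smp w k (A s)).
  by move=> [us _ [/= -> ]].
apply: countable_bigcupT_measurable => [|us].
  exact: countableP.
by apply: measurableI; [case: smpP => h _; exact: h|exact: IH].
Qed.

Lemma chain_fun_measurable (D : set Omega) t k s (f : S -> \bar R) :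
  measurable D -> 
  measurable_fun D ((fun w => f (chain_run (smp w) k t s)) : Omega -> \bar R).
Proof.
move=> mD _ Y mY; apply: measurableI => //.
exact: (chain_run_measurable t k s (f @^-1` Y)).
Qed.

Definition sample_prefix k (As : nat -> {fset node L}) (uss : nat -> seq (node L)) :=
  [set w | forall i, (i < k)%N -> smp w i (As i) = uss i].

Lemma sample_prefix_measurable k As uss : measurable (sample_prefix k As uss).
Proof.
elim: k => [|k IH].
  rewrite [X in measurable X](_ : _ = setT); first exact: measurableT.
  by apply/seteqP; split.
rewrite [X in measurable X](_ : _ =
   (sample_prefix k As uss `&` [set w | smp w k (As k) = uss k])%classic).
  by apply: measurableI => //; case: smpP => h _; exact: h.
apply/seteqP; split => w.
  by move=> h; split=> [i ik|]; apply: h => //; exact: ltnW.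
by move=> [h1 h2] i; rewrite ltnS leq_eqVlt => /orP[/eqP->|/h1].
Qed.

Definition valid (A : {fset node L}) (us : seq (node L)) :=
  [/\ size us = kappa, uniq us & {subset us <= A}].

Lemma mem_words_valid (B : {fset node L}) us :
  us \in words kappa (enum_fset B) <-> valid B us.
Proof.
rewrite mem_words ?fset_uniq //; split.
  by move=> /and3P[/eqP ? ? /allP ?].
by move=> [-> -> /allP ->]; rewrite eqxx.
Qed.

Definition update_from T k (f : nat -> T) x := fun i => if (i < k)%N then f i else x.

Lemma sample_prefix_update k As uss B us :
  sample_prefix k.+1 (update_from k As B) (update_from k uss us) =
  (sample_prefix k As uss `&` [set w | smp w k B = us])%classic.
Proof.
apply/seteqP; split => w.
  move=> h; split=> [i ik|].
    by have := h i (leqW ik); rewrite /update_from ik.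
  by have := h k (ltnSn k); rewrite /update_from ltnn.
move=> [h1 h2] i; rewrite ltnS /update_from leq_eqVlt => /orP[/eqP->|ik].
  by rewrite ltnn.
by rewrite ik; exact: h1.
Qed.

Definition sample_prefix_prob k (As : nat -> {fset node L}) : R :=
  \prod_(i < k) ((#|` As i| ^_ kappa)%:R : R)^-1.

Lemma sample_prefix_prob_update k As B : sample_prefix_prob k.+1 (update_from k As B) =
  sample_prefix_prob k As * ((#|` B| ^_ kappa)%:R)^-1.
Proof.
rewrite /sample_prefix_prob big_ord_recr /= /update_from ltnn; congr (_ * _).
by apply: eq_bigr => i _; rewrite ltn_ord.
Qed.

Lemma sample_prefix_probE k As uss : (forall i, (i < k)%N -> valid (As i) (uss i)) ->
  (P : {measure set Omega -> \bar R}) (sample_prefix k As uss) = (sample_prefix_prob k As)%:E.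
Proof. by move=> h; case: smpP => _; apply. Qed.

(** The hypothesis on the samples speaks of prescribed sets [As i], while the sets
    used by the process depend on the past.  So the past is fixed first: the
    event that the first samples are [uss] is split according to the next sample,
    up to a null set, and on each part the next state is known. *)
Lemma chain_bound (Psi : nat -> S -> R) :
  (forall t s, 0 <= Psi t s) ->
  (forall t s, I s ->
    \sum_(us <- words kappa (enum_fset (A s))) Psi t (next us s) <=
    (#|` A s| ^_ kappa)%:R * Psi t.+1 s) ->
  forall t k s As uss, I s -> (forall i, (i < k)%N -> valid (As i) (uss i)) ->
  (\int[P]_(w in sample_prefix k As uss) (Psi 0%N (chain_run (smp w) k t s))%:E <=
   (sample_prefix_prob k As * Psi t s)%:E)%E.
Proof.
move=> Psi0 Psi_next; elim=> [|t IH] k s As uss Is val_.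
  rewrite /= (_ : (fun=> _) = cst (Psi 0%N s)%:E) // integral_cst.
    by rewrite sample_prefix_probE // -EFinM mulrC.
  exact: sample_prefix_measurable.
pose mu : {measure set Omega -> \bar R} := P.
set ws := words kappa (enum_fset (A s)).
set M : R := (#|` A s| ^_ kappa)%:R.
have M0 : 0 < M by rewrite ltr0n ffact_gt0 enough.
pose G us := sample_prefix k.+1 (update_from k As (A s)) (update_from k uss us).
have mG us : measurable (G us) by exact: sample_prefix_measurable.
have valG us : us \in ws -> forall i, (i < k.+1)%N ->
    valid (update_from k As (A s) i) (update_from k uss us i).
  move=> /mem_words_valid h i; rewrite ltnS leq_eqVlt => /orP[/eqP->|ik].
    by rewrite /update_from ltnn.
  by rewrite /update_from ik; exact: val_.
have PG us : us \in ws -> mu (G us) = (sample_prefix_prob k As / M)%:E.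
  by move=> h; rewrite /mu sample_prefix_probE ?sample_prefix_prob_update //; exact: valG.
have tG : trivIset [set` ws] G.
  apply/trivIsetP => us us' _ _ /eqP uu; apply/seteqP; split => // w.
  by rewrite /G !sample_prefix_update => -[[_ /= h1] [_ /= h2]]; apply: uu; rewrite -h1 -h2.
have uws : uniq ws by apply: words_uniq; exact: fset_uniq.
set U := \big[setU/classical_sets.set0]_(us <- ws) G us.
have mU : measurable U by apply: bigsetU_measurable.
have sizews : (size ws)%:R = M by rewrite size_words.
have PU : mu U = (sample_prefix_prob k As)%:E.
  transitivity (\int[mu]_(w in U) cst 1 w)%E; first by rewrite integral_cst // mul1e.
  have mc : measurable_fun U (cst 1%E : Omega -> \bar R) by exact: measurable_cst.
  rewrite (ge0_integral_bigsetU mu mG uws tG mc); last by move=> w _; rewrite lee_fin.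
  rewrite (eq_big_seq (fun=> (sample_prefix_prob k As / M)%:E)); last first.
    by move=> us h; rewrite integral_cst // mul1e PG.
  rewrite sumEFin big_const_seq count_predT iter_addr_0 -mulr_natr sizews.
  by rewrite -mulrA mulVf ?mulr1 // gt_eqF.
have UG us : us \in ws -> (G us `<=` U)%classic.
  by move=> h w Gw; rewrite /U -bigcup_seq; exists us.
have Upre : (U `<=` sample_prefix k As uss)%classic.
  by rewrite /U -bigcup_seq => w [us _]; rewrite /G sample_prefix_update => -[].
(* the samples that are not sequences of [kappa] distinct elements of [A s] *)
set N := (sample_prefix k As uss `\` U)%classic.
have mpre := sample_prefix_measurable k As uss.
have mN : measurable N by exact: measurableD.
have PN : mu N = 0.
  have Ppre : mu (sample_prefix k As uss) = (sample_prefix_prob k As)%:E by exact: sample_prefix_probE.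
  have fin : (mu (sample_prefix k As uss) < +oo)%E by rewrite Ppre ltry.
  rewrite (measureD mpre mU fin) (setIidr Upre).
  by rewrite [X in (X - _)%E]Ppre [X in (_ - X)%E]PU subee.
have eqpre : sample_prefix k As uss = (U `|` N)%classic by rewrite setDUK.
rewrite -/mu eqpre ge0_integral_setU //; first last.
- by apply/disj_setPS => w [? []].
- by move=> w _; rewrite lee_fin.
- exact: (chain_fun_measurable _ _ _ (fun s => (Psi 0%N s)%:E) (measurableU _ _ mU mN)).
rewrite [X in (_ + X)%E]null_set_integral //; last first.
  exact: (chain_fun_measurable _ _ _ (fun s => (Psi 0%N s)%:E)).
rewrite adde0 (ge0_integral_bigsetU mu mG uws tG); first last.
- by move=> w _; rewrite lee_fin.
- exact: (chain_fun_measurable _ _ _ (fun s => (Psi 0%N s)%:E)).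
apply: (@le_trans _ _ (\sum_(us <- ws) (sample_prefix_prob k As / M * Psi t (next us s))%:E)%E).
  rewrite big_seq [leRHS]big_seq; apply: lee_sum => us uw.
  have := IH k.+1 (next us s) _ _ (next_I us Is) (valG us uw).
  rewrite sample_prefix_prob_update; apply: le_trans.
  rewrite le_eqVlt; apply/orP; left; apply/eqP; apply: eq_integral => w.
  by rewrite inE /G sample_prefix_update /= => -[_ /= ->].
rewrite sumEFin lee_fin -mulr_sumr -mulrA ler_wpM2l //.
  by apply: prodr_ge0 => i _; rewrite invr_ge0.
by rewrite ler_pdivrMl //; exact: Psi_next.
Qed.

(** The expectation of a function of the final state is at most its value at the
    start if it decreases on average; [t] counts the remaining steps. *)
Lemma chain_expectation (Psi : nat -> S -> R) :
  (forall t s, 0 <= Psi t s) ->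
  (forall t s, I s ->
    \sum_(us <- words kappa (enum_fset (A s))) Psi t (next us s) <=
    (#|` A s| ^_ kappa)%:R * Psi t.+1 s) ->
  forall t s, I s ->
  (\int[P]_w (Psi 0%N (chain_run (smp w) 0 t s))%:E <= (Psi t s)%:E)%E.
Proof.
move=> h1 h2 t s Is.
have := @chain_bound Psi h1 h2 t 0%N s (fun=> fset0) (fun=> [::]) Is.
rewrite /sample_prefix_prob big_ord0 mul1r.
rewrite (_ : sample_prefix 0 _ _ = setT); last by apply/seteqP; split.
by apply.
Qed.

End Chain.

(** * The potential *)

Section Steps.
Variables (R : realType) (V : finType) (e : rel V) (W : {set V}).
Variables (d : V -> V -> R).
Hypothesis dm : tree_metric e d.
Hypothesis low_degree : forall v, (degree e v <= 2)%N -> v \in W.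
Local Notation L := {v : V | v \in W}.
Variable choice : {fset node L} -> node L.
Hypothesis choice_in : forall A, A != fset0 -> choice A \in A.
Local Notation recovery := (recovery e d).
Local Notation nonrep B := (bset B `\ brep B).
Local Notation dW := (fun a b : L => d (val a) (val b)).
Variable Delta : nat.
Hypothesis degD : (max_degree e <= Delta)%N.
Hypothesis D2 : (2 <= Delta)%N.

(** Steps that draw no sample are given one from an arbitrary set that is large
    enough, so that all the steps follow the same law. *)
Definition sample_set (st : state R L) : {fset node L} :=
  if queue st is B :: _ then
    if (bsize B <= Delta)%N then [fset x in [seq (inr i : node L) | i <- iota 0 Delta]]
    else nonrep B
  else [fset x in [seq (inr i : node L) | i <- iota 0 Delta]].

Definition tree_step (us : seq (node L)) (st : state R L) : state R L :=
  step choice dW Delta Delta (fun=> us) st.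

Lemma step_sample smp st :
  step choice dW Delta Delta smp st = tree_step (smp (sample_set st)) st.
Proof.
by rewrite /tree_step /step /sample_set; case: (queue st) => // B Q; case: ifP.
Qed.

Lemma tree_run_chain u smp t : tree_run choice dW Delta Delta u smp t =
  chain_run sample_set tree_step smp 0 t (init_state R u).
Proof.
elim: t => // t IH; rewrite chain_run_last -IH -[LHS]/(step _ _ _ _ _ _).
by rewrite step_sample.
Qed.

Definition sound (st : state R L) :=
  (exists f, recovery f (queue st) (output st) (fresh st)) /\
  every (fun B => (1 < bsize B)%N) (queue st).

Lemma bsize_init (u : L) (B0 : bag R L) :
  bsize (head B0 (queue (init_state R u))) = #|W|.
Proof.
rewrite /bsize card_fseq undup_id ?map_inj_uniq -?enumT ?enum_uniq // => [|x y []//].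
by rewrite size_map -cardE card_sig; apply: eq_card => v; rewrite !inE.
Qed.

Lemma sound_init (u : L) : (1 < #|W|)%N -> sound (init_state R u).
Proof.
move=> W2; pose f (x : node L) := if x is inl w then val w else val u.
rewrite /init_state; set B := Bag _ _ _.
have memB x : (x \in bset B) = is_regular x.
  rewrite /= in_fset /=; apply/mapP/idP => [[w _ ->]//|].
  by case: x => // w _; exists w; rewrite ?mem_enum.
have lab : labels f by [].
have g : represents d f 0 B [set~ val u]%SET.
  split; rewrite /= -?[f (inl u)]/(val u).
  - by rewrite (memB (inl u)).
  - by [].
  - by rewrite !inE eqxx.
  - by move=> v w _; rewrite (branch_sym dm) => /(branch_neq dm); rewrite !inE.
  - move=> x; rewrite -/(bset B) memB; case: x => // w _ wu; exists w => //.
    by rewrite !inE; apply: contra wu => /eqP/val_inj->.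
  - by move=> w _; rewrite -/(bset B) memB.
  - by [].
have regE := bag_region dm low_degree lab g.
split; last first.
  apply/every_cons; split=> //; rewrite -/B.
  by have := bsize_init u B; rewrite /= -/B => ->.
exists f; split=> //=.
- by apply/every_cons; split=> //; rewrite -/B regE.
- by move=> v; rewrite /overlap /= addn0; case: (_ \in _).
- by move=> x y; rewrite !inE => /eqP-> /eqP->.
- by move=> x; rewrite inE => /eqP->; rewrite /overlap /= -/B regE !inE eqxx.
- move=> x y exy; right; rewrite /overlap /= -/B regE !inE !addn0.
  have := edge_neq dm exy; case: (eqVneq x (val u)) => [->|_ _] //=.
  by rewrite eq_sym => ->.
Qed.

Lemma sound_enough st : sound st -> (Delta <= #|` sample_set st|)%N.
Proof.
have dflt : (Delta <= #|` [fset x in [seq (inr i : node L) | i <- iota 0 Delta]]|)%N.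
  rewrite card_fseq undup_id ?size_map ?size_iota //.
  by rewrite map_inj_uniq ?iota_uniq // => x y [].
rewrite /sound /sample_set; case: (queue st) => // B Q [[f rec] _].
case: (leqP (bsize B) Delta) => // h; rewrite -ltnS -bsize_nonrep //.
by have /every_cons[g _] := recovery_bags rec; exact: (bag_rep g).
Qed.

Lemma sound_step us st : sound st -> sound (tree_step us st).
Proof.
rewrite /sound /tree_step /step; case Q0: (queue st) => [|B Q]; first by rewrite Q0.
move=> [[f rec] /every_cons[B1 Q1]].
case: ifP => small.
  have [f' [E' [c' [h1 h2 _]]]] := solve_recovery dm low_degree choice_in rec.
  rewrite [run_prog _ _]surjective_pairing -/(result _ _) h1 /=.
  by split=> //; exists f'.
have [f' [Cs [E' [c' [h1 [h2 cc] h3 _ _]]]]] :=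
  bigsplit_pass_recovery dm low_degree choice_in us degD rec.
rewrite [run_prog _ _]surjective_pairing -/(result _ _) h1 /=; case: ifP => _ /=.
  split; last first.
    by apply/every_cat; split=> //; apply: every_imp h3 => C [].
  by exists f'; apply: recovery_perm h2 => P; rewrite !count_cat addnC.
split; first by exists f; exact: recovery_le rec.
exact/every_cons.
Qed.


Let D0 : (0 : R) < Delta%:R. Proof. by rewrite ltr0n; exact: leq_trans D2. Qed.

Let lnD0 : 0 < ln (Delta%:R : R).
Proof. by rewrite ln_gt0 // (ltr_nat _ 1). Qed.

(** The weight of a bag is the number of its nodes besides the representative,
    which is additive under splitting; the logarithmic factor bounds
    the number of passes that a node has still to go through successfully. *)
Definition potential (B : bag R L) : R :=
  70 * Delta%:R * (bsize B).-1%:R * (1 + 2 * (ln (bsize B)%:R / ln Delta%:R)).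

Definition total_potential (st : state R L) : R :=
  \sum_(B <- queue st) potential B.

Lemma ln_bsize_ge0 (B : bag R L) : (1 < bsize B)%N ->
  0 <= ln ((bsize B)%:R : R) / ln Delta%:R.
Proof.
move=> h; apply: divr_ge0; last exact: ltW.
by rewrite ln_ge0 // (ler_nat _ 1) ltnW.
Qed.

Lemma potential_ge (B : bag R L) : (1 < bsize B)%N ->
  70 * Delta%:R * (bsize B).-1%:R <= potential B.
Proof.
move=> h; rewrite /potential ler_peMr ?mulr_ge0 //.
by rewrite lerDl mulr_ge0 // ln_bsize_ge0.
Qed.

Lemma total_potential_ge0 (bs : seq (bag R L)) :
  every (fun B => (1 < bsize B)%N) bs -> 0 <= \sum_(B <- bs) potential B.
Proof.
elim: bs => [_|B bs IH /every_cons[h /IH h2]]; first by rewrite big_nil.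
rewrite big_cons addr_ge0 //; apply: le_trans (potential_ge h).
by rewrite !mulr_ge0.
Qed.

(** The logarithm to base Delta of each size drops by at least 1/2. *)
Lemma potential_split (B : bag R L) (Cs : seq (bag R L)) : (1 < bsize B)%N ->
  every (fun C => (1 < bsize C)%N) Cs ->
  (\sum_(C <- Cs) (bsize C).-1 <= (bsize B).-1)%N ->
  (max_bsize Cs)%:R <= (bsize B)%:R / Num.sqrt (Delta%:R : R) ->
  \sum_(C <- Cs) potential C <= potential B - 70 * Delta%:R * (bsize B).-1%:R.
Proof.
move=> B1 Cs1 sumle maxle.
set l : R := 2 * (ln (bsize B)%:R / ln Delta%:R).
have l0 : 0 <= l by rewrite mulr_ge0 // ln_bsize_ge0.
have -> : potential B - 70 * Delta%:R * (bsize B).-1%:R =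
  70 * Delta%:R * l * (bsize B).-1%:R by rewrite /potential -/l; ring.
apply: (@le_trans _ _ (70 * Delta%:R * l * (\sum_(C <- Cs) (bsize C).-1)%N%:R)); last first.
  by rewrite ler_wpM2l ?ler_nat // mulr_ge0 // mulr_ge0 // ltW.
have sD0 : 0 < Num.sqrt (Delta%:R : R) by rewrite sqrtr_gt0.
have main (C : bag R L) : (1 < bsize C)%N -> (bsize C <= max_bsize Cs)%N ->
    potential C <= 70 * Delta%:R * l * (bsize C).-1%:R.
  move=> C1 Cmax.
  rewrite [leRHS](_ : _ = 70 * Delta%:R * (bsize C).-1%:R * l); last by ring.
  rewrite /potential ler_wpM2l ?mulr_ge0 //.
  have C0 : 0 < (bsize C)%:R :> R by rewrite ltr0n ltnW.
  have B0 : 0 < (bsize B)%:R :> R by rewrite ltr0n ltnW.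
  have Cy : (bsize C)%:R <= (bsize B)%:R / Num.sqrt (Delta%:R : R).
    by apply: le_trans maxle; rewrite ler_nat.
  have : ln ((bsize C)%:R : R) <= ln ((bsize B)%:R / Num.sqrt Delta%:R).
    by rewrite ler_ln ?posrE // divr_gt0.
  rewrite ln_div ?posrE // => h.
  have lnD : ln (Delta%:R : R) = 2 * ln (Num.sqrt (Delta%:R : R)).
    by rewrite -[in LHS](sqr_sqrtr (ltW D0)) lnXn // mulr_natl.
  rewrite /l -(ler_pM2r lnD0) mulrDl mul1r -!mulrA mulVf ?gt_eqF // !mulr1.
  by rewrite lnD; lra.
have maxE : every (fun C => (bsize C <= max_bsize Cs)%N) Cs.
  rewrite /max_bsize; elim: (Cs) => // C s IH; rewrite big_cons.
  apply/every_cons; split; first exact: leq_maxl.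
  by apply: every_imp IH => C' h; apply: leq_trans h _; exact: leq_maxr.
have {}main s : every (fun C => (1 < bsize C)%N /\
    (bsize C <= max_bsize Cs)%N) s ->
    \sum_(C <- s) potential C <=
    70 * Delta%:R * l * (\sum_(C <- s) (bsize C).-1)%N%:R; last first.
  by apply: main; exact: every_and.
elim: s => [_|C s IH]; first by rewrite !big_nil mulr0.
move=> /every_cons[[h1 h2] /IH h]; rewrite !big_cons natrD mulrDr.
by apply: lerD h; exact: main.
Qed.

Definition live (st : state R L) : bool := ~~ nilp (queue st).

Lemma dead_step us st : ~~ live st -> tree_step us st = st.
Proof. by rewrite /live /tree_step /step; case: (queue st). Qed.

Lemma every_counterexample T (P Q : T -> Prop) s :
  every P s -> ~ every Q s -> exists2 x, P x & ~ Q x.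
Proof.
elim: s => [_ []//|x s IH] /every_cons[Px Ps] nQ.
have [Qx|] := pselect (Q x); last by exists x.
by apply: IH => // Qs; apply: nQ; apply/every_cons.
Qed.

(** The queries made so far and a bound for the expected number of those to come. *)
Definition value (st : state R L) : R := (nqueries st)%:R + total_potential st.

Lemma value_ge0 st : sound st -> 0 <= value st.
Proof. by move=> [_ h]; rewrite addr_ge0 // total_potential_ge0. Qed.

Lemma solve_value us B Q st : sound st -> queue st = B :: Q ->
  (bsize B <= Delta)%N -> value (tree_step us st) <= value st - 1.
Proof.
rewrite /sound /value /total_potential /tree_step /step => -[[f rec] sz] E small.
rewrite E small; rewrite E in rec sz.
have [f' [E' [c' [h1 h2 h3]]]] := solve_recovery dm low_degree choice_in rec.
rewrite [run_prog _ _]surjective_pairing -/(result _ _) -/(cost _ _) h1 /=.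
move: sz => /every_cons[B1 _]; rewrite big_cons.
have := potential_ge B1; set q := cost _ _ in h3 *.
have : (q.+1 <= 70 * Delta * (bsize B).-1)%N by move: h3; nia.
by rewrite -(ler_nat R) !natrM -natr1 natrD; lra.
Qed.

Definition pass_fails (B : bag R L) c us : bool :=
  ~~ ((max_bsize (result dW (bigsplit_pass choice B us c)).1.1)%:R <=
      (bsize B)%:R / Num.sqrt (Delta%:R : R)).

Lemma pass_value us B Q st : sound st -> queue st = B :: Q ->
  (Delta < bsize B)%N -> size us = Delta ->
  value (tree_step us st) <= value st + 6 * Delta%:R * (bsize B).-1%:R -
    70 * Delta%:R * (bsize B).-1%:R * (~~ pass_fails B (fresh st) us)%:R.
Proof.
rewrite /sound /value /total_potential /tree_step /step /pass_fails.
move=> [[f rec] sz] E big sus; rewrite E; rewrite E in rec sz.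
have [f' [Cs [E' [c' [h1 _ h3 h4 h5]]]]] :=
  bigsplit_pass_recovery dm low_degree choice_in us degD rec.
rewrite leqNgt big /= [run_prog _ _]surjective_pairing -/(result _ _) -/(cost _ _).
rewrite h1 /=; set q := cost _ _ in h5 *.
move: sz => /every_cons[B1 _].
have qle : (q <= 6 * Delta * (bsize B).-1)%N by move: h5; rewrite sus; nia.
rewrite -(ler_nat R) !natrM in qle.
case: ifP => ok /=; rewrite !big_cons natrD; last by lra.
rewrite big_cat /= mulr1.
have Cs1 : every (fun C => (1 < bsize C)%N) Cs by apply: every_imp h3 => C [].
have := potential_split B1 Cs1 h4 ok; lra.
Qed.

(** The chain around a node consists of the branches beyond a vertex on the way to
    it from the representative.  The critical size [h] is the integer part of the
    bound [y] on sizes: a bag larger than [y] has at least [h] nodes besides its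
    representative. *)
Lemma count_pass_fails B Q E c f : recovery f (B :: Q) E c ->
  (Delta < bsize B)%N ->
  (10 * count (pass_fails B c) (words Delta (enum_fset (nonrep B))) <=
   9 * #|` nonrep B| ^_ Delta)%N.
Proof.
move=> rec big; set A := nonrep B.
have gB : represents d f c B (region d f B) by have /every_cons[] := recovery_bags rec.
have sizeB : bsize B = #|` A|.+1 := bsize_nonrep (bag_rep gB).
have Dm : (Delta <= #|` A|)%N by rewrite -ltnS -sizeB.
pose y : R := (bsize B)%:R / Num.sqrt Delta%:R.
have s0 : 0 < Num.sqrt (Delta%:R : R) by rewrite sqrtr_gt0.
have y1 : 1 <= y.
  rewrite /y ler_pdivlMr // mul1r -(@ler_pXn2r _ 2) ?nnegrE ?sqrtr_ge0 //.
  rewrite sqr_sqrtr; last exact: ltW.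
  by rewrite -natrX ler_nat; move: big; nia.
have /andP[hy yh] := truncn_itv (le_trans ler01 y1).
set h := Num.truncn y in hy yh.
apply: (@fail_fraction R Delta #|` A| h) => //; first by rewrite -sizeB.
pose F (x : node L) (C : {fset node L}) := exists (q : V) (v : L),
  [/\ x = inl v, between d (f (brep B)) q (val v) & C = branch_nodes W d q (val v)].
apply: (count_fails (F := F)).
- move=> x H1 H2 [q [v [-> b1 ->]]] [q' [v' [[<-] b2 ->]]].
  exact: (branch_nodes_chain W dm b1 b2).
- by rewrite truncn_gt0.
move=> us; rewrite /pass_fails.
have [f' [Cs [E' [c' [h1 _ h3 _ _]]]]] :=
  bigsplit_pass_recovery dm low_degree choice_in us degD rec.
rewrite h1 /= -/y => maxy.
have notall : ~ every (fun C => (bsize C)%:R <= y) Cs.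
  move=> all_le; move: maxy; apply/negP/negPn.
  rewrite /max_bsize; elim: (Cs) all_le => [|C s IH].
    by move=> _; rewrite big_nil; apply: le_trans y1.
  move=> /every_cons[k1 /IH k2]; rewrite big_cons.
  by case: (leqP (bsize C) (\max_(C <- s) bsize C)) => _.
have [C [C1 CB sub miss one] Cy] := every_counterexample h3 notall.
exists (nonrep C); split=> //.
- rewrite -ltnS -bsize_nonrep // -(ltr_nat R).
  by apply: le_lt_trans hy _; rewrite ltNge; apply/negP.
- move=> x xC; have [w xw] : exists w, x = inl w.
    have := fsubsetP sub _ xC; rewrite (bag_mem_region (recovery_labels rec) gB).
    by case: (x) => // w _; exists w.
  subst x; have [q hq ->] := one _ xC; by exists q, w.
Qed.

(** A pass on a bag of weight [w] costs at most [6 Delta w], and wins [70 Delta w]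
    with probability at least 1/10. *)
Lemma step_value st : sound st -> live st ->
  \sum_(us <- words Delta (enum_fset (sample_set st))) value (tree_step us st) <=
  (#|` sample_set st| ^_ Delta)%:R * (value st - 1).
Proof.
move=> snd; rewrite /live; case E: (queue st) => [|B Q] // _.
have const (k : R) : (#|` sample_set st| ^_ Delta)%:R * k =
    \sum_(us <- words Delta (enum_fset (sample_set st))) k.
  by rewrite big_const_seq count_predT iter_addr_0 size_words mulr_natl.
have [small|big] := leqP (bsize B) Delta.
  rewrite const; apply: ler_sum => us _; exact: solve_value E small.
have AE : sample_set st = nonrep B by rewrite /sample_set E leqNgt big.
have [[f rec] sz] := snd; rewrite E in rec sz.
have B1 : (1 < bsize B)%N by move: sz => /every_cons[].
have cf := count_pass_fails rec big.
set ws := words _ _; set w : R := (bsize B).-1%:R.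
have w1 : 1 <= w by rewrite (ler_nat _ 1); move: B1; lia.
apply: (@le_trans _ _ (\sum_(us <- ws) (value st + 6 * Delta%:R * w -
    70 * Delta%:R * w * (~~ pass_fails B (fresh st) us)%:R))).
  rewrite big_seq [leRHS]big_seq; apply: ler_sum => us; rewrite mem_words ?fset_uniq //.
  by move=> /and3P[/eqP sus _ _]; exact: pass_value E big sus.
rewrite sumrB -const -mulr_sumr -natr_sum sum_nat_of_bool.
set M : nat := (_ ^_ _)%N.
have cM : (M <= 10 * count (fun us => ~~ pass_fails B (fresh st) us) ws)%N.
  have := count_predC (pass_fails B (fresh st)) ws; rewrite size_words -/M.
  by move: cf; rewrite -AE -/ws -/M; set c1 := count _ _; set c2 := count _ _; lia.
set c := count _ _ in cM *; rewrite -(ler_nat R) natrM in cM.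
have DR : 2 <= (Delta%:R : R) by rewrite (ler_nat _ 2).
have Dw : 1 * 1 <= Delta%:R * w by apply: ler_pM => //; lra.
rewrite mulr1 in Dw.
have M0 : 0 <= (M%:R : R) by [].
set X := Delta%:R * w in Dw.
have e1 : 70 * Delta%:R * w * c%:R = 7 * X * (10 * c%:R) by rewrite /X; ring.
have e2 : 7 * X * M%:R <= 7 * X * (10 * c%:R) by rewrite ler_wpM2l //; lra.
have e3 : M%:R * (value st + 6 * Delta%:R * w) = M%:R * (value st + 6 * X).
  by rewrite /X; ring.
rewrite e1 e3; apply: (@le_trans _ _ (M%:R * (value st + 6 * X) - 7 * X * M%:R)).
  by rewrite lerB.
rewrite (_ : _ - _ = M%:R * (value st - X)); last by ring.
by rewrite ler_wpM2l // lerB.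
Qed.

(** For a run of [N] steps of which [t] remain.  The second summand is the number of
    steps made so far, while the queue is not empty; after the last step, its
    expectation is [N] times the probability that the queue is not empty. *)
Definition horizon_value (N t : nat) st : R :=
  if `[< sound st >] then value st + (N - t)%:R * (live st)%:R else 0.

Lemma horizon_value_ge0 N t st : 0 <= horizon_value N t st.
Proof.
rewrite /horizon_value; case: asboolP => // h.
by rewrite addr_ge0 ?mulr_ge0 // value_ge0.
Qed.

Lemma horizon_value_step N t st : sound st ->
  \sum_(us <- words Delta (enum_fset (sample_set st)))
     horizon_value N t (tree_step us st) <=
  (#|` sample_set st| ^_ Delta)%:R * horizon_value N t.+1 st.
Proof.
move=> snd.
have const (k : R) : (#|` sample_set st| ^_ Delta)%:R * k =
    \sum_(us <- words Delta (enum_fset (sample_set st))) k.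
  by rewrite big_const_seq count_predT iter_addr_0 size_words mulr_natl.
have valE s us : sound us -> horizon_value N s us = value us + (N - s)%:R * (live us)%:R.
  by move=> h; rewrite /horizon_value asboolT.
have [l|l] := boolP (live st); last first.
  rewrite const; apply: ler_sum => us _.
  by rewrite dead_step // !valE // (negPf l) !mulr0.
apply: (@le_trans _ _ (\sum_(us <- words Delta (enum_fset (sample_set st)))
    (value (tree_step us st) + (N - t)%:R))).
  apply: ler_sum => us _; rewrite valE; last exact: sound_step.
  by rewrite lerD2l ler_piMr //; case: (live _).
rewrite big_split /= -const valE // l mulr1.
have := step_value snd l; set M : R := _%:R; set Sm := \sum_(_ <- _) _.
have M0 : 0 <= M by [].
have : (N - t)%:R <= (N - t.+1)%:R + 1 :> R by rewrite natr1 ler_nat; lia.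
move=> /(ler_wpM2l M0) => h1 h2; apply: le_trans (lerD h2 h1) _.
by rewrite -mulrDr addrA addrAC subrK.
Qed.

End Steps.

Lemma step_nqueries (R : realType) (L : finType) (choice : {fset node L} -> node L)
    (d : L -> L -> R) Delta kappa smp (st : state R L) :
  (nqueries st <= nqueries (step choice d Delta kappa smp st))%N.
Proof.
rewrite /step; case: (queue st) => [//|B Q]; case: ifP => _.
  by case: (run_prog _ _) => q [E c]; rewrite leq_addr.
by case: (run_prog _ _) => q [[Cs E] c]; case: ifP => _; rewrite leq_addr.
Qed.

(** Without bags there are no regions, so every edge has been output. *)
Lemma recovers_done (R : realType) (V : finType) (e : rel V) (W : {set V})
    (d : V -> V -> R) f E c :
  symmetric e -> recovery e d f [::] E c -> recovers (W := W) e E.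
Proof.
move=> sym rec; exists f; split.
- exact: (recovery_labels rec).
- by have := recovery_inj rec; rewrite /nodes cats0.
move=> x y; split=> [/(recovery_cover rec)[[a aE h]|//]|[a aE h]].
  by exists a.
by have := recovery_edge rec aE; case: h => -[<- <-] //; rewrite sym.
Qed.

(** * Queries and termination *)

Section Main.
Variables (R : realType) (V : finType) (e : rel V) (W : {set V}).
Variables (d : V -> V -> R).
Hypothesis dm : tree_metric e d.
Hypothesis low_degree : forall v, (degree e v <= 2)%N -> v \in W.
Local Notation L := {v : V | v \in W}.
Variable choice : {fset node L} -> node L.
Hypothesis choice_in : forall A, A != fset0 -> choice A \in A.
Local Notation dW := (fun a b : L => d (val a) (val b)).
Variable Delta : nat.
Hypothesis degD : (max_degree e <= Delta)%N.
Hypothesis D2 : (2 <= Delta)%N.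
Hypothesis DW : (Delta <= #|W|)%N.
Variables (disp : measure_display) (Omega : measurableType disp).
Variables (P : probability Omega R) (u : L).
Variable smp : Omega -> nat -> {fset node L} -> seq (node L).
Hypothesis smpP : uniform_samples P Delta smp.

Let run w t := tree_run choice dW Delta Delta u (smp w) t.
Let init := init_state R u.
Let soundS : state R L -> Prop := sound e d.

Let sound0 : soundS init.
Proof. by apply: (sound_init dm low_degree); exact: leq_trans DW. Qed.

Lemma run_sound w t : soundS (run w t).
Proof.
elim: t => // t IH; rewrite /run /= step_sample.
exact: (sound_step dm low_degree choice_in degD).
Qed.

Let runE w t : run w t = chain_run (@sample_set R V W Delta)
  (tree_step d choice Delta) (smp w) 0 t init.
Proof. exact: tree_run_chain. Qed.

Lemma run_horizon N t :
  (\int[P]_w (horizon_value e d Delta N 0 (run w t))%:E <=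
   (horizon_value e d Delta N t init)%:E)%E.
Proof.
rewrite (eq_integral (fun w => (horizon_value e d Delta N 0
  (chain_run (@sample_set R V W Delta) (tree_step d choice Delta) (smp w) 0 t init))%:E)).
  apply: (chain_expectation smpP (I := soundS)) => //.
  - by move=> us s; exact: (sound_step dm low_degree choice_in degD).
  - exact: (sound_enough).
  - by move=> s st; exact: horizon_value_ge0.
  - by move=> s st; exact: horizon_value_step.
by move=> w _; rewrite runE.
Qed.

Lemma value_init : horizon_value e d Delta 0 0 init <=
  210 * Delta%:R * #|W|%:R * (ln (#|W|%:R : R) / ln Delta%:R).
Proof.
rewrite /horizon_value asboolT // mul0r addr0 /value /= add0r.
rewrite /total_potential /= big_seq1 /potential.
have := bsize_init u (Bag fset0 (inl u) (fun=> 0 : R)); rewrite /= => ->.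
have D0 : 0 < Delta%:R :> R by rewrite ltr0n ltnW.
have lnD0 : 0 < ln (Delta%:R : R) by rewrite ln_gt0 // (ltr_nat _ 1).
set r := ln _ / _.
have r1 : 1 <= r.
  rewrite /r ler_pdivlMr // mul1r ler_ln ?posrE ?ler_nat // ltr0n.
  by apply: leq_trans DW; exact: ltnW.
rewrite -!mulrA [210 * _](_ : _ = 70 * (Delta%:R * (#|W|%:R * (3 * r)))); last by ring.
rewrite ler_pM2l // ler_pM2l // ler_pM //; last by lra.
  by lra.
by rewrite ler_nat leq_pred.
Qed.

Lemma nqueries_le_value w t :
  (nqueries (run w t))%:R <= horizon_value e d Delta 0 0 (run w t).
Proof.
rewrite /horizon_value asboolT; last exact: run_sound.
rewrite mul0r addr0 /value lerDl; have [_ h] := run_sound w t.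
exact: (total_potential_ge0 D2).
Qed.

Lemma run_measurable (D : set Omega) t (f : state R L -> \bar R) : measurable D ->
  measurable_fun D ((fun w => f (run w t)) : Omega -> \bar R).
Proof.
move=> mD; have -> : (fun w => f (run w t)) = (fun w => f (chain_run
  (@sample_set R V W Delta) (tree_step d choice Delta) (smp w) 0 t init)).
  by apply/funext => w; rewrite runE.
exact: (chain_fun_measurable smpP).
Qed.

Lemma expected_queries :
  (\int[P]_w total_queries choice dW Delta Delta u (smp w) <=
   (210 * Delta%:R * #|W|%:R * (ln (#|W|%:R : R) / ln Delta%:R))%:E)%E.
Proof.
pose g (t : nat) (w : Omega) : \bar R := ((nqueries (run w t))%:R : R)%:E.
have gmono w : {homo g^~ w : n m / (n <= m)%N >-> (n <= m)%E}.
  apply/nondecreasing_seqP => t; rewrite /g lee_fin ler_nat; exact: step_nqueries.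
have -> : (\int[P]_w total_queries choice dW Delta Delta u (smp w) =
    \int[P]_w limn (g^~ w))%E.
  by apply: eq_integral => w _; apply/esym/cvg_lim => //; exact: ereal_nondecreasing_cvgn.
have mg t : measurable_fun setT (g t).
  exact: (run_measurable t (fun s => ((nqueries s)%:R : R)%:E)).
have g0 t w : setT w -> (0 <= g t w)%E by move=> _; rewrite lee_fin.
have gm w : setT w -> {homo g^~ w : n m / (n <= m)%N >-> (n <= m)%E} by [].
rewrite (monotone_convergence P measurableT mg g0 gm).
apply: lime_le.
  by apply: cvgP; exact: (cvg_monotone_convergence measurableT mg g0 gm).
apply: nearW => t; apply: le_trans (_ : (horizon_value e d Delta 0 t init)%:E <= _)%E; last first.
  by rewrite lee_fin; apply: le_trans value_init; rewrite /horizon_value asboolT // !mul0r.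
apply: le_trans (run_horizon 0 t); apply: ge0_le_integral => //.
- by move=> w _; rewrite lee_fin.
- exact: (run_measurable t (fun s => (horizon_value e d Delta 0 0 s)%:E)).
- by move=> w _; rewrite lee_fin; exact: nqueries_le_value.
Qed.

(** The probability that the queue is never empty is at most the initial potential
    divided by [t], for every [t]. *)
Lemma ae_halted : {ae P, forall w, exists t, halted (run w t)}.
Proof.
pose Z := [set w | forall t, live (run w t)].
pose Zt t := [set w | live (run w t)].
have mZt t : measurable (Zt t).
  have -> : Zt t = [set w | [set s | live s] (chain_run
      (@sample_set R V W Delta) (tree_step d choice Delta) (smp w) 0 t init)].
    by apply/seteqP; split=> w; rewrite /Zt /= runE.
  by apply: (chain_run_measurable smpP).
have ZE : Z = \bigcap_t Zt t.
  by apply/seteqP; split=> w h t; [move=> _; exact: h|exact: h].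
have mZ : measurable Z by rewrite ZE; apply: bigcap_measurable => //; exists 0%N.
exists Z; split=> //.
  set v := horizon_value e d Delta 0 0 init.
  have bound t : (t%:R%:E * P Z <= v%:E)%E.
    have h1 := run_horizon t t.
    have -> : v = horizon_value e d Delta t t init.
      by rewrite /v /horizon_value asboolT // !subnn.
    apply: le_trans h1.
    apply: (@le_trans _ _ (\int[P]_(w in Z) (horizon_value e d Delta t 0 (run w t))%:E)%E).
      rewrite -integral_cst //.
      have mc : measurable_fun Z (cst t%:R%:E : Omega -> \bar R).
        exact: measurable_cst.
      have mh := run_measurable t (fun s => (horizon_value e d Delta t 0 s)%:E) mZ.
      apply: (ge0_le_integral P mZ _ mc mh); first by move=> w _; rewrite lee_fin.
      move=> w Zw; rewrite lee_fin /horizon_value asboolT; last exact: run_sound.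
      rewrite (Zw t) mulr1 subn0 lerDr; apply: (value_ge0 D2 (run_sound w t)).
    apply: ge0_subset_integral => //.
      exact: (run_measurable t (fun s => (horizon_value e d Delta t 0 s)%:E)).
    by move=> w _; rewrite lee_fin horizon_value_ge0.
  have fin : P Z \is a fin_num by exact: fin_num_measure.
  have z0 : 0 <= fine (P Z) by exact: fine_ge0.
  rewrite -(fineK fin); congr (_%:E); apply/eqP; rewrite eq_le z0 andbT.
  rewrite leNgt; apply/negP => zpos.
  have := bound (Num.truncn (v / fine (P Z))).+1.
  rewrite -(fineK fin) -EFinM lee_fin -ler_pdivlMr // leNgt => /negP; apply.
  have v0 : 0 <= v / fine (P Z) by rewrite divr_ge0 // horizon_value_ge0.
  by have /andP[] := truncn_itv v0.
move=> w nh t; have [//|dead] := boolP (live (run w t)); case: nh; exists t.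
by move: dead; rewrite /live negbK /halted; case: (queue _).
Qed.
End Main.

Theorem theorem3p1 (R : realType) :
  exists C : R,
  forall (V : finType) (e : rel V) (W : {set V}) (ell : V -> V -> R)
    (Delta n : nat)
    (d := fun u v : {x : V | x \in W} => tree_dist e ell (val u) (val v))
    (choice : {fset node {x : V | x \in W}} -> node {x : V | x \in W})
    (u : {x : V | x \in W})
    (disp : measure_display) (Omega : measurableType disp)
    (P : probability Omega R)
    (smp : Omega -> nat -> {fset node {x : V | x \in W}} ->
           seq (node {x : V | x \in W})),
  semi_labeled_tree e W ->
  edge_lengths e ell ->
  Delta = max_degree e -> (2 <= Delta)%N ->
  n = #|W| ->
  (forall A, A != fset0 -> choice A \in A) ->
  uniform_samples P Delta smp ->
  {ae P, forall w : Omega, exists t : nat,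
     halted (tree_run choice d Delta Delta u (smp w) t) /\
     recovers e (output (tree_run choice d Delta Delta u (smp w) t))} /\
  (\int[P]_w total_queries choice d Delta Delta u (smp w) <=
    (C * Delta%:R * n%:R * (ln (n%:R : R) / ln (Delta%:R : R)))%:E)%E.
Proof.
exists 210 => V e W ell Delta n d choice u disp Omega P smp [tr low] lengths DE D2.
move=> nE choice_in smpP.
have dm := tree_distP tr lengths.
have degD : (max_degree e <= Delta)%N by rewrite DE.
have DW : (Delta <= #|W|)%N by rewrite DE (max_degree_le_regular dm low).
split; last first.
  by rewrite nE; exact: (expected_queries dm low choice_in degD D2 DW u smpP).
have := ae_halted dm low choice_in degD D2 DW u smpP.
apply: filterS => w [t h]; exists t; split=> //.
have [[f rec] _] := run_sound dm low choice_in degD D2 DW u smp w t.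
rewrite h in rec; apply: recovers_done rec.
by case: tr.
Qed.
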